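(* Let $\alpha\in(0,1)$ and $b>0$. Let $\mathbf{X}=(X_1,\dots,X_n)$ be a random vector taking values in $[-b,b]^n$ and let $Y$ be a discrete random variable taking values in a countable set $\mathcal{Y}$. For a parameter $\theta\in\mathbb{R}^k$, let $f_Y(y;\theta)$ be the probability mass function of $Y$ and $f_{\mathbf{X}|Y}(\mathbf{x}|y;\theta)$ the probability density function of $\mathbf{X}$ given $Y=y$. Let $r:[-b,b]^n\times\mathcal{Y}\to\mathbb{R}$ be bounded, set $R=r(\mathbf{X},Y)$, and let $f_R(\cdot;\theta)$ denote the probability density function of $R$. Assume: (1) $R$ is a continuous random variable for all $\theta$; for all $\theta$ and $1\le j\le k$ the derivatives $\frac{\partial}{\partial\theta_j}\nu_\alpha(R;\theta)$ and $\frac{\partial}{\partial\theta_j}\Phi_\alpha(R;\theta)$ are well defined and bounded; and $\frac{\partial\log f_{\mathbf{X}|Y}(\mathbf{x}|y;\theta)}{\partial\theta_j}$ and $\frac{\partial\log f_Y(y;\theta)}{\partial\theta_j}$ exist and are bounded for all $\mathbf{x}$, $y$ and $\theta$; (2) for all $y\in\mathcal{Y}$ and all $\theta$, the level set $\mathcal{D}_{y;\theta}=\{\mathbf{x}\in[-b,b]^n: r(\mathbf{x},y)\le\nu_\alpha(R;\theta)\}$ may be written as a finite union $\mathcal{D}_{y;\theta}=\bigcup_{i=1}^{L_{y;\theta}}D^i_{y;\theta}$ of disjoint, closed, connected components $D^i_{y;\theta}$, each with positive measure; (3) for all $\theta$ (and each $1\le j\le k$), $f_R(\cdot;\theta)$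 and $g(\cdot;\theta)$ are continuous at $\nu_\alpha(R;\theta)$, and $f_R(\nu_\alpha(R;\theta);\theta)>0$, where $$g(\beta;\theta)=\mathbb{E}^\theta\left[\left.\left(\frac{\partial\log f_Y(Y;\theta)}{\partial\theta_j}+\frac{\partial\log f_{\mathbf{X}|Y}(\mathbf{X}|Y;\theta)}{\partial\theta_j}\right)\bigl(R-\nu_\alpha(R;\theta)\bigr)\,\right|\,R=\beta\right].$$ Let $(\mathbf{x}_1,y_1),\dots,(\mathbf{x}_N,y_N)$ be drawn i.i.d. from the joint distribution $f_{\mathbf{X},Y}(\cdot,\cdot;\theta)$ of $(\mathbf{X},Y)$, and let $\Delta_{j;N}$ be the GCVaR gradient estimator computed from these samples (defined in the context). Then, for every $\theta$ and $1\le j\le k$, the bias $\mathbb{E}[\Delta_{j;N}]-\frac{\partial}{\partial\theta_j}\Phi_\alpha(R;\theta)$ is $O(N^{-1/2})$ as $N\to\infty$.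
   Context: A random variable $R$ is called continuous if its cumulative distribution function $F_R(z)=\Pr(R\le z)$ is everywhere continuous. For $\alpha\in(0,1)$, the $\alpha$-Value-at-Risk (the $\alpha$-quantile) of $R$ is $\nu_\alpha(R)=\inf\{z:F_R(z)\ge\alpha\}$, and the $\alpha$-Conditional-Value-at-Risk (CVaR) of $R$ is $\Phi_\alpha(R)=\mathbb{E}[R\mid R\le\nu_\alpha(R)]$. When the distribution depends on a parameter $\theta$, $\nu_\alpha(R;\theta)$ and $\Phi_\alpha(R;\theta)$ denote these quantities when the parameter is $\theta$, and $\mathbb{E}^\theta$ denotes expectation under the distribution with parameter $\theta$. GCVaR estimator: given samples $(\mathbf{x}_1,y_1),\dots,(\mathbf{x}_N,y_N)$, let $\hat F(z)=\frac1N\sum_{i=1}^N\mathbf{1}_{r(\mathbf{x}_i,y_i)\le z}$ be the empirical C.D.F. of $R$ and let $\tilde v=\inf\{z:\hat F(z)\ge\alpha\}$ be the empirical $\alpha$-quantile (equivalently, the $\lceil\alpha N\rceil$-th smallest of the values $r(\mathbf{x}_i,y_i)$). Then $$\Delta_{j;N}=\frac{1}{\alpha N}\sum_{i=1}^N\left(\frac{\partial\log f_Y(y_i;\theta)}{\partial\theta_j}+\frac{\partial\log f_{\mathbf{X}|Y}(\mathbf{x}_i|y_i;\theta)}{\partial\theta_j}\right)\bigl(r(\mathbf{x}_i,y_i)-\tilde v\bigr)\mathbf{1}_{r(\mathbf{x}_i,y_i)\le\tilde v}.$$ *)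

(* Defs.v *)
From HB Require Import structures.
From mathcomp Require Import all_boot all_order all_algebra.
From mathcomp Require Import all_classical all_reals all_analysis.

Set Implicit Arguments.
Unset Strict Implicit.
Unset Printing Implicit Defensive.

Import Order.TTheory GRing.Theory Num.Theory.
Import numFieldNormedType.Exports.

Local Open Scope classical_set_scope.
Local Open Scope ring_scope.

(* The library has no Lebesgue measure in dimension n; it is built here
   on n.-tuple R, which carries the product sigma-algebra, by iterating the
   binary product of measures. *)
Section lebesgue_tuple.
Variable R : realType.
Local Open Scope ereal_scope.

Definition pair_tuple n (p : R * n.-tuple R) : n.+1.-tuple R :=
  [tuple of p.1 :: p.2].

Fixpoint lebesgue_tuple n : set (n.-tuple R) -> \bar R :=
  match n with
  | 0 => \d_[tuple]
  | m.+1 => fun A =>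
      (@lebesgue_measure R \x @lebesgue_tuple m) (@pair_tuple m @^-1` A)
  end.

Lemma measurable_pair_tuple n : measurable_fun [set: R * n.-tuple R] (@pair_tuple n).
Proof. exact: measurable_cons. Qed.

Lemma lebesgue_tupleE n : exists mu : {sigma_finite_measure set (n.-tuple R) -> \bar R},
  @lebesgue_tuple n = mu :> (set (n.-tuple R) -> \bar R).
Proof.
elim: n => [|n [mu IH]]; first by exists (\d_([tuple] : 0.-tuple R)).
pose lxmu : {measure set (measurableTypeR R * n.-tuple R) -> \bar R} :=
  (@lebesgue_measure R \x mu).
pose nu := pushforward lxmu (@pair_tuple n : _ -> n.+1.-tuple R).
have mpt := @measurable_pair_tuple n.
have nu0 : nu set0 = 0 by rewrite /nu /pushforward preimage_set0 measure0.
have nu_ge0 A : 0 <= nu A by exact: measure_ge0.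
have nu_sa : semi_sigma_additive nu.
  move=> F mF tF mUF; rewrite /nu /pushforward preimage_bigcup.
  apply: measure_semi_sigma_additive.
  - by move=> i; rewrite -[X in measurable X]setTI; exact: mpt.
  - apply/trivIsetP => /= i j _ _ ij; rewrite -preimage_setI.
    by move/trivIsetP : tF => /(_ _ _ _ _ ij) ->//; rewrite preimage_set0.
  - by rewrite -preimage_bigcup -[X in measurable X]setTI; exact: mpt.
have nu_sf : sigma_finite setT nu.
  have /sigma_finiteP[F [FT ndF Foo]] := sigma_finiteT (@lebesgue_measure R).
  have /sigma_finiteP[G [GT ndG Goo]] := sigma_finiteT mu.
  pose u (x : n.+1.-tuple R) : measurableTypeR R * n.-tuple R :=
    (thead x, [tuple of behead x]).
  have mmu : measurable_fun setT u.
    apply: measurable_fun_pair; last exact: measurable_behead.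
    exact: (@measurable_tnth _ R _ ord0).
  have uK x : u (pair_tuple x) = x.
    by case: x => x s; rewrite /u /=; congr pair; exact: val_inj.
  exists (fun k => u @^-1` (F k `*` G k)).
    apply/seteqP; split => // x _.
    have : [set: R] (u x).1 by []. rewrite FT => -[i _ Fi].
    have : [set: n.-tuple R] (u x).2 by []. rewrite GT => -[j _ Gj].
    exists (maxn i j) => //; split.
      by move/subsetPset : (ndF _ _ (leq_maxl i j)); exact.
    by move/subsetPset : (ndG _ _ (leq_maxr i j)); exact.
  move=> k; have [mF Fk] := Foo k; have [mG Gk] := Goo k; split.
    by rewrite -[X in measurable X]setTI; apply: mmu => //; exact: measurableX.
  rewrite /nu /pushforward -comp_preimage (_ : u \o _ = id); last exact/funext.
  rewrite preimage_id /lxmu /= product_measure1E//.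
  by rewrite lte_mul_pinfty// ge0_fin_numE.
have -> : @lebesgue_tuple n.+1 = nu by rewrite /= IH.
clearbody nu.
pose m1 := isMeasure.Build _ _ _ nu nu0 nu_ge0 nu_sa.
pose nm : {measure set (n.+1.-tuple R) -> \bar R} := HB.pack nu m1.
pose m2 := Measure_isSigmaFinite.Build _ _ _ nm nu_sf.
pose ns : {sigma_finite_measure set (n.+1.-tuple R) -> \bar R} :=
  HB.pack nu m1 m2.
by exists ns.
Qed.

Variable n : nat.

Let lebesgue_tuple0 : @lebesgue_tuple n set0 = 0.
Proof. by have [mu ->] := lebesgue_tupleE n; exact: measure0. Qed.

Let lebesgue_tuple_ge0 A : 0 <= @lebesgue_tuple n A.
Proof. by have [mu ->] := lebesgue_tupleE n; exact: measure_ge0. Qed.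

Let lebesgue_tuple_sigma_additive : semi_sigma_additive (@lebesgue_tuple n).
Proof.
by have [mu ->] := lebesgue_tupleE n; exact: measure_semi_sigma_additive.
Qed.

HB.instance Definition _ := isMeasure.Build _ _ _ (@lebesgue_tuple n)
  lebesgue_tuple0 lebesgue_tuple_ge0 lebesgue_tuple_sigma_additive.

Let lebesgue_tuple_sigma_finite : sigma_finite setT (@lebesgue_tuple n).
Proof. by have [mu ->] := lebesgue_tupleE n; exact: sigma_finiteT. Qed.

HB.instance Definition _ := Measure_isSigmaFinite.Build _ _ _
  (@lebesgue_tuple n) lebesgue_tuple_sigma_finite.

End lebesgue_tuple.

Section geometry.
Context {R : realType} {n : nat}.

Definition cube (b : R) : set (n.-tuple R) :=
  [set x | forall i, - b <= tnth x i <= b].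

(* n.-tuple R has no topology in the library: the topology of R^n is taken
   from row vectors through this bijection. *)
Definition tuple_of_row (v : 'rV[R]_n) : n.-tuple R := [tuple v ord0 i | i < n].

(* Closed, connected, pairwise disjoint pieces, finite in number, are exactly
   the connected components of their union; L = 0 is the empty level set. *)
Definition finite_union_of_components (D : set (n.-tuple R)) : Prop :=
  exists (L : nat) (C : 'I_L -> set (n.-tuple R)),
    [/\ D = \bigcup_i C i,
        trivIset setT C,
        forall i, closed (@tuple_of_row @^-1` C i),
        forall i, connected (@tuple_of_row @^-1` C i) &
        forall i, (0 < lebesgue_tuple (C i))%E].

End geometry.

Section densities.
Context d (Omega : measurableType d) (R : realType) (P : probability Omega R).

Definition is_pdf (X : {mfun Omega >-> R}) (f : R -> R) : Prop :=
  [/\ measurable_fun setT f, forall z, 0 <= f z &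
      forall A, measurable A ->
        distribution P X A = (\int[lebesgue_measure]_(z in A) (f z)%:E)%E].

Context {dY} {YT : measurableType dY}.

Definition is_pmf (Y : {mfun Omega >-> YT}) (f : YT -> R) : Prop :=
  forall y, P (Y @^-1` [set y]) = (f y)%:E.

(* Only the values of f on the cube are constrained, since X lives there. *)
Definition is_cond_pdf n (b : R) (X : {mfun Omega >-> n.-tuple R})
    (Y : {mfun Omega >-> YT}) (f : n.-tuple R -> YT -> R) : Prop :=
  forall y,
    [/\ measurable_fun (cube b) (f ^~ y),
        forall x, cube b x -> 0 <= f x y,
        (\int[@lebesgue_tuple R n]_(x in cube b) (f x y)%:E = 1)%E &
        forall A, measurable A ->
          P (X @^-1` A `&` Y @^-1` [set y]) =
          (P (Y @^-1` [set y]) *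
           \int[@lebesgue_tuple R n]_(x in A `&` cube b) (f x y)%:E)%E].

(* g is a version of beta |-> E[Z | X = beta]. *)
Definition is_cond_mean (Z : Omega -> R) (X : {mfun Omega >-> R})
    (g : R -> R) : Prop :=
  [/\ P.-integrable setT (EFin \o Z),
      measurable_fun setT g,
      P.-integrable setT (EFin \o (g \o X)) &
      forall A, measurable A ->
        (\int[P]_(w in X @^-1` A) (Z w)%:E =
         \int[P]_(w in X @^-1` A) (g (X w))%:E)%E].

End densities.

Section risk.
Context d (Omega : measurableType d) (R : realType).
Variables (a : R) (P : probability Omega R) (X : {mfun Omega >-> R}).

Definition VaR : R := inf [set z : R | (a%:E <= cdf (P := P) X z)%E].

Definition cond_mean_event (A : set Omega) : R :=
  (\int[P]_(w in A) X w) / fine (P A).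

Definition CVaR : R := cond_mean_event [set w | X w <= VaR].

End risk.

Section score.
Context {R : realType} {k n : nat} {YT : Type}.

Definition partial (j : 'I_k) (f : 'rV[R]_k -> R) (theta : 'rV[R]_k) : R :=
  'D_(delta_mx ord0 j) f theta.

Definition has_partial (j : 'I_k) (f : 'rV[R]_k -> R) (theta : 'rV[R]_k) : Prop :=
  derivable f theta (delta_mx ord0 j).

Definition score (fY : 'rV[R]_k -> YT -> R)
    (fXY : 'rV[R]_k -> n.-tuple R -> YT -> R)
    (j : 'I_k) (theta : 'rV[R]_k) (x : n.-tuple R) (y : YT) : R :=
  partial j (fun t => ln (fY t y)) theta +
  partial j (fun t => ln (fXY t x y)) theta.

End score.

Section estimator.
Context {R : realType} {N : nat}.

Definition empirical_cdf (v : 'I_N -> R) (z : R) : R :=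
  N%:R^-1 * \sum_(i < N) (v i <= z)%R%:R.

Definition empirical_VaR (a : R) (v : 'I_N -> R) : R :=
  inf [set z | a <= empirical_cdf v z].

Definition GCVaR {n} {YT : Type} (a : R) (r : n.-tuple R -> YT -> R)
    (sc : n.-tuple R -> YT -> R) (s : 'I_N -> n.-tuple R * YT) : R :=
  let v i := r (s i).1 (s i).2 in
  let q := empirical_VaR a v in
  (a * N%:R)^-1 *
  \sum_(i < N) sc (s i).1 (s i).2 * (v i - q) * (v i <= q)%R%:R.

End estimator.

Definition iid_sample d dE (T : measurableType d) (E : measurableType dE)
    (R : realType) (Q : probability T R) (N : nat)
    (S : 'I_N -> {mfun T >-> E}) (law : set E -> \bar R) : Prop :=
  (forall i A, measurable A -> Q (S i @^-1` A) = law A) /\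
  (forall (J : {set 'I_N}) (A : 'I_N -> set E),
     (forall i, measurable (A i)) ->
     Q (\bigcap_(i in [set` J]) S i @^-1` A i) =
     (\prod_(i in J) Q (S i @^-1` A i))%E).

(* Main.v *)
(* The proof does not differentiate under the moving level sets. For each
   parameter t the Rockafellar-Uryasev functional
   [q - a^-1 E_t max(q - R, 0)] is maximal at the quantile of R, where its value
   is CVaR(t). Freezing q at the quantile nu of the parameter theta therefore
   gives a minorant of CVaR that touches it at theta, so both have the same
   partial derivative there; the derivative of the minorant is computed by
   rewriting E_t as an expectation under theta weighted by the likelihood ratio
   and by dominated convergence. This yields
   [partial CVaR = - a^-1 E_theta (score * max(nu - R, 0))].
   The estimator is the empirical version of the right-hand side with nu
   replaced by the empirical quantile, on which it depends in a Lipschitz way,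
   hence its bias is at most a constant times the mean absolute error of the
   empirical quantile. Since the density of R is positive near nu, the c.d.f.
   grows at least linearly around nu, Chebyshev's inequality bounds the
   probability of an error greater than t by O(1 / (N t^2)), and summing over
   dyadic t gives a mean error O(N^(-1/2)). *)

Require Import Defs.
From HB Require Import structures.
From mathcomp Require Import all_boot all_order all_algebra.
From mathcomp Require Import all_classical all_reals all_analysis.
From mathcomp Require Import measurable_realfun.
From mathcomp Require Import ring lra.

Set Implicit Arguments.
Unset Strict Implicit.
Unset Printing Implicit Defensive.

Import Order.TTheory GRing.Theory Num.Theory.
Import numFieldNormedType.Exports.

Local Open Scope classical_set_scope.
Local Open Scope ring_scope.

(** * Change of measure *)

Section density_transfer.
Context d d' (T : measurableType d) (U : measurableType d') (R : realType).
Variables (nu : {measure set T -> \bar R}) (mu : {measure set U -> \bar R}).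
Variables (X : T -> U) (D : set T) (E : set U) (f : U -> R).
Hypotheses (mX : measurable_fun setT X) (mD : measurable D) (mE : measurable E).
Hypothesis XE : forall w, D w -> E (X w).
Hypotheses (mf : measurable_fun E f) (f0 : forall x, E x -> 0 <= f x).
Hypothesis nuE : forall A, measurable A ->
  nu (X @^-1` A `&` D) = (\int[mu]_(x in A `&` E) (f x)%:E)%E.

Import HBNNSimple.
Local Open Scope ereal_scope.

(** Both sides are limits of the same integrals for simple functions [h n] increasing to [g], by
    monotone convergence; for an indicator the identity is [nuE]. *)
Lemma ge0_integral_comp_density (g : U -> \bar R) :
  measurable_fun E g -> (forall x, E x -> 0 <= g x) ->
  \int[nu]_(w in D) g (X w) = \int[mu]_(x in E) (g x * (f x)%:E).
Proof.
move=> mg g0; pose h := nnsfun_approx mE mg.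
have mfE : measurable_fun E (EFin \o f) by exact/measurable_EFinP.
have hX n : measurable_fun setT (h n \o X) by exact: measurableT_comp.
have -> : \int[nu]_(w in D) g (X w) =
    lim (\int[nu]_(w in D) (EFin \o h n) (X w) @[n --> \oo]).
  under eq_integral => w /[!inE] Dw.
    have <- : lim ((EFin \o h n) (X w) @[n --> \oo]) = g (X w).
      by apply/cvg_lim => //; apply: cvg_nnsfun_approx => //; exact: XE.
    over.
  apply: monotone_convergence => //.
  - by move=> n; apply/measurable_EFinP; exact: (measurable_funTS (hX n)).
  - by move=> n w Dw /=; rewrite lee_fin.
  - by move=> w Dw p q pq; rewrite lee_fin; exact/lefP/nd_nnsfun_approx.
have -> : \int[mu]_(x in E) (g x * (f x)%:E) =
    lim (\int[mu]_(x in E) ((h n x)%:E * (f x)%:E) @[n --> \oo]).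
  under eq_integral => x /[!inE] Ex.
    have <- : lim ((h n x)%:E * (f x)%:E @[n --> \oo]) = g x * (f x)%:E.
      by apply/cvg_lim => //; apply: cvgeZr => //; exact: cvg_nnsfun_approx.
    over.
  apply: monotone_convergence => //.
  - move=> n; apply: emeasurable_funM => //.
    by apply: measurable_funTS; exact/measurable_EFinP.
  - by move=> n x Ex; rewrite -EFinM lee_fin mulr_ge0// f0.
  - move=> x Ex p q pq; rewrite -!EFinM lee_fin ler_wpM2r ?f0//.
    exact/lefP/nd_nnsfun_approx.
have mXA A : measurable A -> measurable (X @^-1` A).
  by move=> mA; rewrite -[X in measurable X]setTI; exact: mX.
suff suf n : \int[mu]_(x in E) ((h n x)%:E * (f x)%:E) =
    \int[nu]_(w in D) (EFin \o h n) (X w).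
  by under [in RHS]eq_fun do rewrite suf.
have hpre r : measurable (h n @^-1` [set r]) by [].
have mhX r : measurable_fun D (fun w => \1_(h n @^-1` [set r]) (X w) : R).
  apply: (measurable_funS measurableT) => //.
  by apply: (measurableT_comp _ mX); exact: measurable_indic.
have mh r : measurable_fun E (fun x => \1_(h n @^-1` [set r]) x : R).
  exact: measurable_indic.
(* Both integrals reduce to this sum over the values [r] of [h n], each weighted by the mass that
   [nu] gives to the corresponding level set. *)
transitivity (\sum_(r \in range (h n))
    r%:E * nu (X @^-1` (h n @^-1` [set r]) `&` D)); last first.
  under [RHS]eq_integral do rewrite /= fimfunE -fsumEFin//.
  rewrite ge0_integral_fsum//; last 2 first.
  - by move=> r; apply/measurable_EFinP; exact: measurable_funM.
  - by move=> r w _; exact: nnfun_muleindic_ge0.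
  apply: eq_fsbigr => r rh.
  under [RHS]eq_integral do rewrite EFinM.
  rewrite [RHS]ge0_integralZl//.
  - rewrite (_ : (fun w => _) = (fun w => (\1_(X @^-1` (h n @^-1` [set r])) w)%:E))//.
    by rewrite integral_indic//; exact: mXA.
  - exact/measurable_EFinP.
  - by move: rh; rewrite inE => -[t _ <-]; rewrite lee_fin.
transitivity (\int[mu]_(x in E) (\sum_(r \in range (h n))
    (r * \1_(h n @^-1` [set r]) x)%:E * (f x)%:E)).
  apply: eq_integral => x xE.
  rewrite -ge0_mule_fsuml => [|r]; last exact: nnfun_muleindic_ge0.
  by rewrite fsumEFin// -(fimfunE _ x).
rewrite ge0_integral_fsum//; last 2 first.
- move=> r; apply: emeasurable_funM => //; apply/measurable_EFinP.
  exact: measurable_funM.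
- by move=> r x Ex; rewrite mule_ge0 ?lee_fin ?f0//; exact: nnfun_muleindic_ge0.
apply: eq_fsbigr => r rh.
under eq_integral do rewrite EFinM -muleA.
rewrite ge0_integralZl//.
- congr (_ * _); rewrite nuE// setIC integral_mkcondr.
  by apply: eq_integral => x xE; rewrite epatch_indic muleC.
- by apply: emeasurable_funM => //; exact/measurable_EFinP.
- by move=> x Ex; rewrite mule_ge0 ?lee_fin ?f0.
- by move: rh; rewrite inE => -[t _ <-]; rewrite lee_fin.
Qed.
End density_transfer.

Section countable_second_component.
Context d dU dY (T : measurableType d) (U : measurableType dU)
  (YT : measurableType dY).
Hypotheses (YTc : countable [set: YT]) (YT1 : forall y : YT, measurable [set y]).
Variable Y : T -> YT.
Hypothesis mY : measurable_fun setT Y.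

(** A preimage splits into countably many pieces along the fibres of [Y], and on the fibre over [y]
    only the section [phi ^~ y] matters. Joint measurability thus follows from that of the
    sections. *)
Lemma measurable_fun_countable2 dV (V : measurableType dV) (phi : U -> YT -> V)
    (X : T -> U) (D : set T) (E : set U) :
  measurable_fun setT X -> measurable D -> measurable E ->
  (forall w, D w -> E (X w)) ->
  (forall y, measurable_fun E (phi ^~ y)) ->
  measurable_fun D (fun w => phi (X w) (Y w)).
Proof.
move=> mX mD mE DE mphi _ B mB.
rewrite (_ : _ `&` _ = D `&` \bigcup_y
    (X @^-1` (E `&` phi ^~ y @^-1` B) `&` Y @^-1` [set y])); last first.
  apply/seteqP; split => [w [Dw Bw]|w [Dw [y _ [[_ Bw] /= Yw]]]].
    by split => //; exists (Y w) => //; split => //; split => //; exact: DE.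
  by rewrite /= Yw.
apply: measurableI => //.
apply: countable_bigcupT_measurable => // y; apply: measurableI.
- by rewrite -[X in measurable X]setTI; apply: mX => //; exact: mphi.
- by rewrite -[X in measurable X]setTI; exact: mY.
Qed.

Local Open Scope ereal_scope.

Lemma eq_integral_countable (R : realType) (P1 P2 : {measure set T -> \bar R})
    (f1 f2 : T -> \bar R) :
  measurable_fun setT f1 -> measurable_fun setT f2 ->
  (forall w, 0 <= f1 w) -> (forall w, 0 <= f2 w) ->
  (forall y, \int[P1]_(w in Y @^-1` [set y]) f1 w =
             \int[P2]_(w in Y @^-1` [set y]) f2 w) ->
  \int[P1]_w f1 w = \int[P2]_w f2 w.
Proof.
move=> mf1 mf2 f10 f20 f12.
have /countable_injP[e inje] := YTc.
(* The fibres of [Y] are reindexed by natural numbers through the injection [e]; [F k] is empty when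
   [k] is not a value of [e]. *)
pose F k := Y @^-1` (e @^-1` [set k]).
have FT : \bigcup_k F k = setT.
  by apply/seteqP; split => // w _; exists (e (Y w)).
have mF k : measurable (F k).
  rewrite -[X in measurable X]setTI; apply: mY => //.
  by apply: countable_measurable => //; apply: sub_countable YTc; exact: subset_card_le.
have tF : trivIset setT F.
  by move=> i j _ _ [w [/= <- <-]].
rewrite -FT !ge0_integral_bigcup//; do ?by rewrite FT.
apply: eq_eseriesr => k _.
have [[y yk]|nk] := pselect (exists y, e y = k).
  rewrite (_ : F k = Y @^-1` [set y])//.
  apply/seteqP; split => [w /= Yw|w /= Yw]; last by rewrite /F /= Yw.
  by apply: inje; rewrite ?inE// yk.
rewrite (_ : F k = set0) ?integral_set0//.
by apply/seteqP; split => // w /= Yw; apply: nk; exists (Y w).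
Qed.

End countable_second_component.

Section change_of_measure.
Context d (Omega : measurableType d) (R : realType) dY (YT : measurableType dY).
Hypotheses (YTc : countable [set: YT]) (YT1 : forall y : YT, measurable [set y]).
Variables (n : nat) (b : R).
Variables (X : {mfun Omega >-> n.-tuple R}) (Y : {mfun Omega >-> YT}).
Hypothesis X_cube : forall w, cube b (X w).

Lemma measurable_cube : measurable (cube b : set (n.-tuple R)).
Proof.
rewrite (_ : cube b = \bigcap_(i in setT) ((@tnth n R)^~ i @^-1` `[- b, b])).
  apply: fin_bigcap_measurable => // i _.
  by rewrite -[X in measurable X]setTI; exact: measurable_tnth.
apply/seteqP; split => [x bx i _ /=|x bx i]; first by rewrite in_itv/=.
by have := bx i Logic.I; rewrite /= in_itv.
Qed.

Local Open Scope ereal_scope.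

(** On the fibre [Y = y], the image of [P] under [X] has Lebesgue density [fY y * fXY x y] on the
    cube, so [ge0_integral_comp_density] applies. *)
Lemma ge0_integral_cond_pdf (P : probability Omega R) (fY : YT -> R)
    (fXY : n.-tuple R -> YT -> R) (phi : n.-tuple R -> R) y :
  is_pmf P Y fY -> is_cond_pdf P b X Y fXY ->
  measurable_fun (cube b) phi -> (forall x, cube b x -> 0 <= phi x)%R ->
  \int[P]_(w in Y @^-1` [set y]) (phi (X w))%:E =
  \int[@lebesgue_tuple R n]_(x in cube b) (phi x * (fY y * fXY x y))%:E.
Proof.
move=> hY /(_ y)[mf f0 _ hf] mphi phi0.
have fY0 : (0 <= fY y)%R by rewrite -lee_fin -hY.
have mC : measurable (cube b : set (n.-tuple R)) by exact: measurable_cube.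
have mYy : measurable (Y @^-1` [set y]).
  by rewrite -[X in measurable X]setTI; exact: measurable_funP.
have mff : measurable_fun (cube b) (fun x => fY y * fXY x y)%R.
  exact: measurable_funM.
have ff0 x : cube b x -> (0 <= fY y * fXY x y)%R.
  by move=> bx; rewrite mulr_ge0// f0.
have hff A : measurable A -> P (X @^-1` A `&` Y @^-1` [set y]) =
    \int[@lebesgue_tuple R n]_(x in A `&` cube b) (fY y * fXY x y)%:E.
  move=> mA; rewrite hf// hY.
  under [RHS]eq_integral do rewrite EFinM.
  rewrite ge0_integralZl//.
  - exact: measurableI.
  - by apply/measurable_EFinP; exact: measurable_funS mf.
  - by move=> x [_ bx]; rewrite lee_fin f0.
apply: (ge0_integral_comp_density _ mYy mC _ mff ff0 hff (g := EFin \o phi)) => //.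
exact/measurable_EFinP.
Qed.

(** [L] is the likelihood ratio of [P1] to [P2], given as a multiplier so that nothing is divided.
    On each fibre of [Y] both sides become the same Lebesgue integral over the cube. *)
Lemma change_of_measure (P1 P2 : probability Omega R) (f1Y f2Y : YT -> R)
    (f1 f2 L phi : n.-tuple R -> YT -> R) :
  is_pmf P1 Y f1Y -> is_pmf P2 Y f2Y ->
  is_cond_pdf P1 b X Y f1 -> is_cond_pdf P2 b X Y f2 ->
  (forall y, measurable_fun (cube b) (L ^~ y)) ->
  (forall x y, cube b x -> 0 <= L x y)%R ->
  (forall x y, cube b x -> f1Y y * f1 x y = L x y * (f2Y y * f2 x y))%R ->
  (forall y, measurable_fun (cube b) (phi ^~ y)) ->
  (forall x y, cube b x -> 0 <= phi x y)%R ->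
  \int[P1]_w (phi (X w) (Y w))%:E =
  \int[P2]_w (phi (X w) (Y w) * L (X w) (Y w))%:E.
Proof.
move=> h1Y h2Y h1 h2 mL L0 f12 mphi phi0.
have mC : measurable (cube b : set (n.-tuple R)) by exact: measurable_cube.
apply: (@eq_integral_countable _ _ _ _ YTc YT1 Y).
- by [].
- apply/measurable_EFinP.
  exact: (measurable_fun_countable2 YTc YT1 _ (E := cube b)).
- apply/measurable_EFinP.
  apply: (measurable_fun_countable2 YTc YT1 _ (E := cube b)
    (phi := fun x y => phi x y * L x y)%R) => // y.
  exact: measurable_funM.
- by move=> w; rewrite lee_fin phi0.
- by move=> w; rewrite lee_fin mulr_ge0 ?phi0 ?L0.
move=> y.
transitivity (\int[P1]_(w in Y @^-1` [set y]) (phi (X w) y)%:E).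
  by apply: eq_integral => w; rewrite inE /= => ->.
transitivity (\int[P2]_(w in Y @^-1` [set y]) (phi (X w) y * L (X w) y)%:E);
  last by apply: eq_integral => w; rewrite inE /= => ->.
rewrite (ge0_integral_cond_pdf (phi := phi ^~ y) y h1Y h1)//; last by move=> x; exact: phi0.
rewrite (ge0_integral_cond_pdf (phi := fun x => phi x y * L x y)%R y h2Y h2)//.
- by apply: eq_integral => x; rewrite inE => bx; rewrite f12// mulrA.
- exact: measurable_funM.
- by move=> x bx; rewrite mulr_ge0 ?phi0 ?L0.
Qed.

End change_of_measure.

(** * Directional derivatives and bounded random variables *)

Section directional_derivative.
Context (R : realType) (V : normedModType R).

(** The two difference quotients coincide. This brings partial derivatives within reach of
    one-variable calculus. *)
Lemma is_derive_line (f : V -> R) (x v : V) (h : R) :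
  derivable f (h *: v + x) v ->
  is_derive h 1 (fun t : R => f (t *: v + x)) ('D_v f (h *: v + x)).
Proof.
move=> df.
have eqf : (fun t : R => t^-1 *:
      (((fun t => f (t *: v + x)) \o shift h) (t *: (1 : R)) - f (h *: v + x))) =
    (fun t => t^-1 *: ((f \o shift (h *: v + x)) (t *: v) - f (h *: v + x))).
  by apply/funext => t; rewrite /= [t *: (1 : R)]mulr1 scalerDl addrA.
by apply: DeriveDef; rewrite /derivable /derive eqf.
Qed.

(** The sequential form of the derivative is the one that fits dominated convergence. *)
Lemma derive_cvg_seq (f : R -> R) (x df : R) (u : nat -> R) :
  is_derive x 1 f df -> (forall m, u m != 0) -> u m @[m --> \oo] --> 0 ->
  (u m)^-1 * (f (u m + x) - f x) @[m --> \oo] --> df.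
Proof.
move=> fdf u0 uc; have dfx : derivable f x 1 by exact: ex_derive.
have : (fun h : R => h^-1 * (f (h + x) - f x)) h @[h --> 0^'] --> df.
  have <- : 'D_1 f x = df by exact: derive_val.
  move: dfx; rewrite /derivable /derive /= => dfx.
  have -> : (fun h : R => h^-1 * (f (h + x) - f x)) =
     (fun h => h^-1 *: (f (h *: (1:R) + x) - f x)).
    by apply/funext => h; rewrite [h *: (1:R)]mulr1.
  exact: dfx.
by move/cvgr_dnbhsP; apply.
Qed.

Lemma derive_bounded_lipschitz (f : V -> R) (v : V) (M : R) :
  (forall x, derivable f x v) -> (forall x, `|'D_v f x| <= M) ->
  forall x (h : R), `|f (h *: v + x) - f x| <= M * `|h|.
Proof.
move=> df Mf x h; pose F (t : R) := f (t *: v + x).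
have dF (t : R) : is_derive t 1 F ('D_v f (t *: v + x)) by exact: is_derive_line.
have cF (i : interval R) : {within [set` i], continuous F}.
  by apply: derivable_within_continuous => t _; have [] := dF t.
have mvt (p q : R) : p <= q -> `|F q - F p| <= M * (q - p).
  move=> pq.
  have [c _ ->] := MVT_segment pq (fun t _ => dF t) (cF `[p, q]).
  by rewrite normrM [X in _ * X]ger0_norm ?subr_ge0// ler_wpM2r// subr_ge0.
have F0 : F 0 = f x by rewrite /F scale0r add0r.
rewrite -F0 -/(F h); have [h0|h0] := leP 0 h.
  by have := mvt 0 h h0; rewrite subr0 (ger0_norm h0).
by have := mvt h 0 (ltW h0); rewrite sub0r distrC (ltr0_norm h0).
Qed.

End directional_derivative.

(** Convexity gives [1 + u <= expR u] and [1 - u <= expR (- u)]. For [u >= 0], multiply the second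
    by [expR u]; for [u < 0], use the first and [1 <= expR (- u)]. *)
Lemma expRB1_le (R : realType) (u : R) : `|expR u - 1| <= `|u| * expR `|u|.
Proof.
have h1 := expR_ge1Dx u; have h2 := expR_ge1Dx (- u).
have e0 := expR_gt0 u.
have ee : expR u * expR (- u) = 1 by rewrite -expRD subrr expR0.
have [u0|u0] := leP 0 u.
- rewrite (ger0_norm u0) ger0_norm; first by nra.
  by rewrite subr_ge0 -expR0 ler_expR.
- rewrite ler0_norm; last by rewrite subr_le0 -expR0 ler_expR ltW.
  rewrite ltr0_norm// opprB.
  have : 1 <= expR (- u) by rewrite -expR0 ler_expR oppr_ge0 ltW.
  nra.
Qed.

(* The difference quotients of f from the left and from the right at 0 are
   bounded by those of H, because f - H is minimal at 0. *)
Lemma envelope_derive (R : realType) (f H : R -> R) (df dH : R) :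
  is_derive (0 : R) 1 f df -> (forall h, H h <= f h) -> H 0 = f 0 ->
  (forall u : nat -> R, (forall m, u m != 0) -> (forall m, `|u m| <= 1) ->
     u m @[m --> \oo] --> 0 ->
     (u m)^-1 * (H (u m) - H 0) @[m --> \oo] --> dH) ->
  df = dH.
Proof.
move=> fdf Hf H0 hH; apply/eqP; rewrite eq_le.
have n0 m : (harmonic m : R) != 0 by rewrite gt_eqF// harmonic_gt0.
have le1 m : `|harmonic m : R| <= 1.
  by rewrite ger0_norm ?harmonic_ge0// /harmonic invf_le1// ler1n.
have q1 : (- harmonic m : R) @[m --> \oo] --> 0.
  by rewrite -oppr0; apply: cvgN; exact: cvg_harmonic.
(* Dividing [H (u m) - H 0 <= f (u m) - f 0] by a negative [u m] reverses it, so [- harmonic] yields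
   [df <= dH]; [harmonic] yields the converse. *)
apply/andP; split.
- have n0' m : - (harmonic m : R) != 0 by rewrite oppr_eq0.
  have le1' m : `|- (harmonic m : R)| <= 1 by rewrite normrN.
  have /= c1 := derive_cvg_seq fdf n0' q1.
  have c2 := hH _ n0' le1' q1.
  apply: ler_cvg_to c1 c2 _; near=> m.
  rewrite addr0 H0 ler_nM2l ?invr_lt0 ?oppr_lt0 ?harmonic_gt0//.
  by rewrite lerD2r.
- have /= c1 := derive_cvg_seq fdf n0 cvg_harmonic.
  have c2 := hH _ n0 le1 cvg_harmonic.
  apply: ler_cvg_to c2 c1 _; near=> m.
  rewrite addr0 H0 ler_pM2l ?invr_gt0 ?harmonic_gt0//.
  by rewrite lerD2r.
Unshelve. all: by end_near. Qed.

(** * Integrals of bounded functions and of finite sums *)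

Section bounded_probability.
Context d (T : measurableType d) (R : realType) (P : probability T R).

Lemma bounded_integrable (f : T -> R) (M : R) :
  measurable_fun setT f -> (forall w, `|f w| <= M) ->
  P.-integrable setT (EFin \o f).
Proof.
move=> mf fM; apply: measurable_bounded_integrable => //.
  by rewrite -ge0_fin_numE //; exact: fin_num_measure.
by exists M; split; [exact: num_real|move=> x Mx w _; exact: le_trans (ltW Mx)].
Qed.

Lemma bounded_Rintegral_cvg (f_ : nat -> T -> R) (f : T -> R) (M : R) :
  (forall m, measurable_fun setT (f_ m)) -> measurable_fun setT f ->
  (forall m w, `|f_ m w| <= M) ->
  (forall w, f_ m w @[m --> \oo] --> f w) ->
  \int[P]_w f_ m w @[m --> \oo] --> \int[P]_w f w.
Proof.
move=> mf_ mf fM ff.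
have M0 : P.-integrable setT (EFin \o cst M) by exact: finite_measure_integrable_cst.
have ff' : {ae P, forall w, setT w -> (f_ m w)%:E @[m --> \oo] --> (f w)%:E}.
  apply/aeW => w _; apply: cvg_EFin; last exact: ff.
  exact: nearW.
have fM' : {ae P, forall w m, setT w -> (`|(f_ m w)%:E| <= (EFin \o cst M) w)%E}.
  by apply/aeW => w m _; rewrite lee_fin.
have [i1 _ h] := dominated_convergence measurableT
  (fun m => (measurable_EFinP _ _).2 (mf_ m)) ((measurable_EFinP _ _).2 mf) ff' M0 fM'.
apply: fine_cvg; rewrite fineK//.
exact: integrable_fin_num.
Qed.

Lemma Rintegral_probability_cst (c : R) : \int[P]_w c = c.
Proof.
by rewrite Rintegral_cst// (congr1 fine (probability_setT P) : fine (P setT) = 1) mulr1.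
Qed.

Lemma integrable_Rsum (I : Type) (s : seq I) (f : I -> T -> R) :
  (forall i, P.-integrable setT (EFin \o f i)) ->
  P.-integrable setT (EFin \o (fun w => \sum_(i <- s) f i w)).
Proof.
move=> fi; rewrite (_ : EFin \o _ = fun w => (\sum_(i <- s) (EFin \o f i) w)%E).
  exact: integrable_sum.
by apply/funext => w; rewrite /= sumEFin.
Qed.

Lemma Rintegral_sum (I : Type) (s : seq I) (f : I -> T -> R) :
  (forall i, P.-integrable setT (EFin \o f i)) ->
  \int[P]_w (\sum_(i <- s) f i w) = \sum_(i <- s) \int[P]_w f i w.
Proof.
move=> fi; elim: s => [|i s IH].
  by under eq_Rintegral do rewrite big_nil; rewrite Rintegral_probability_cst big_nil.
under eq_Rintegral do rewrite big_cons.
by rewrite RintegralD// ?big_cons ?IH//; exact: integrable_Rsum.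
Qed.

End bounded_probability.

(** * Value-at-Risk and Conditional Value-at-Risk *)

Section value_at_risk.
Context d (Omega : measurableType d) (R : realType) (P : probability Omega R).
Variables (X : {mfun Omega >-> R}) (a M : R).
Hypotheses (a01 : 0 < a < 1) (XM : forall w, `|X w| <= M).
Hypothesis cX : continuous (cdf (P := P) X).

Let F z := fine (cdf (P := P) X z).
Let nu := VaR a P X.

Lemma cdfE z : cdf (P := P) X z = P [set w | X w <= z].
Proof.
by congr (P _); apply/seteqP; split => w /=; rewrite in_itv.
Qed.

Let FE z : cdf (P := P) X z = (F z)%:E.
Proof. by rewrite fineK// fin_num_measure. Qed.

Let F_nd p q : p <= q -> F p <= F q.
Proof. by move=> pq; rewrite -lee_fin -!FE cdf_nondecreasing. Qed.

Let F_cont (x : R) : F y @[y --> x] --> F x.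
Proof. by apply: fine_cvg; rewrite -FE; exact: cX. Qed.

Let FM : a <= F M.
Proof.
rewrite -lee_fin -FE cdfE (_ : [set _ | _] = setT).
  by rewrite probability_setT lee_fin ltW//; case/andP : a01.
by apply/seteqP; split => // w _ /=; rewrite (le_trans (ler_norm _)).
Qed.

Let FNM z : z < - M -> F z = 0.
Proof.
move=> zM; apply: EFin_inj; rewrite -FE cdfE (_ : [set _ | _] = set0) ?measure0//.
apply/seteqP; split => // w /= Xz.
have := le_lt_trans Xz zM; rewrite ltrNr => /(lt_le_trans)/(_ (ler_norm _)).
by rewrite normrN ltNge XM.
Qed.

Let VaRE : nu = inf [set z | a <= F z].
Proof.
by congr inf; apply/seteqP; split => z /=; rewrite FE lee_fin.
Qed.

Let lbM : lbound [set z | a <= F z] (- M).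
Proof.
move=> z /= az; rewrite leNgt; apply/negP => /FNM Fz0.
by move: az; rewrite Fz0 leNgt; case/andP : a01 => ->.
Qed.

(** The set whose infimum is taken contains [M], where the c.d.f. is 1, and has no point below
    [- M], where the c.d.f. is 0. *)
Lemma VaR_norm_le : `|VaR a P X| <= M.
Proof.
rewrite ler_norml -/nu VaRE; apply/andP; split.
  by apply: lb_le_inf => //; exists M.
by apply: ge_inf => //; exists (- M).
Qed.

(** If [F nu] exceeded [a], continuity would put a point left of [nu] in the set whose infimum is
    [nu]; if it were below [a], continuity and monotonicity would keep that set away from [nu]. *)
Lemma cdf_VaR : fine (cdf (P := P) X (VaR a P X)) = a.
Proof.
rewrite -/nu -/(F nu); apply/eqP; rewrite eq_le !leNgt; apply/andP; split.
- apply/negP => aF.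
  have /nbhs_ballP[e /= e0 he] : nbhs nu [set y | a < F y].
    exact: (cvgr_gt (F nu) (@F_cont nu) _ aF).
  have h : a < F (nu - e / 2).
    by apply: he; rewrite /ball/= opprB addrC subrK gtr0_norm; lra.
  have : nu <= nu - e / 2.
    rewrite {1}VaRE; apply: ge_inf; first by exists (- M).
    exact: ltW.
  lra.
- apply/negP => aF.
  have /nbhs_ballP[e /= e0 he] : nbhs nu [set y | F y < a].
    exact: (cvgr_lt (F nu) (@F_cont nu) _ aF).
  have h : F (nu + e / 2) < a.
    by apply: he; rewrite /ball/= opprD addNKr normrN gtr0_norm; lra.
  have hinf : has_inf [set z | a <= F z] by split; [exists M|exists (- M)].
  have e20 : 0 < e / 2 by rewrite divr_gt0.
  have [z /= az] := inf_adherent e20 hinf.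
  rewrite -VaRE => /ltW/F_nd Fz.
  by have := le_lt_trans (le_trans az Fz) h; rewrite ltxx.
Qed.

Let A := [set w | X w <= nu].

Let mA : measurable A.
Proof.
rewrite (_ : A = X @^-1` `]-oo, nu]); last first.
  by apply/seteqP; split => w /=; rewrite in_itv.
by rewrite -[X in measurable X]setTI; exact: measurable_funP.
Qed.

Let mX : measurable_fun setT X. Proof. exact: measurable_funP. Qed.

Let PA : fine (P A) = a. Proof. by rewrite -cdfE cdf_VaR. Qed.

Let aCVaR : a * CVaR a P X = \int[P]_w (X w * \1_A w).
Proof.
have a0 : a != 0 by case/andP : a01 => a0 _; rewrite gt_eqF.
rewrite /CVaR /cond_mean_event -/nu -/A PA Rintegral_mkcond mulrCA divff// mulr1.
by apply: eq_Rintegral => w _; rewrite patch_indic.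
Qed.

Let iXA : P.-integrable setT (EFin \o (fun w => X w * \1_A w)).
Proof.
apply: (@bounded_integrable _ _ _ _ _ M); first exact: measurable_funM.
move=> w; rewrite normrM -[M]mulr1 ler_pM//.
by rewrite indicE; case: (_ \in _); rewrite ?normr1 ?normr0.
Qed.

Let iqA q : P.-integrable setT (EFin \o (fun w => q * \1_A w)).
Proof.
apply: (@bounded_integrable _ _ _ _ _ `|q|); first exact: measurable_funM.
move=> w; rewrite normrM -[leRHS]mulr1 ler_pM//.
by rewrite indicE; case: (_ \in _); rewrite ?normr1 ?normr0.
Qed.

Let imax q : P.-integrable setT (EFin \o (fun w => Num.max (q - X w) 0)).
Proof.
apply: (@bounded_integrable _ _ _ _ _ (`|q| + M)).
  by apply: measurable_maxr => //; exact: measurable_funB.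
move=> w; rewrite ger0_norm ?le_max ?lexx ?orbT// ge_max; apply/andP; split.
  by rewrite (le_trans (ler_norm _))// (le_trans (ler_normB _ _))// lerD2l.
by rewrite addr_ge0// (le_trans (normr_ge0 (X point))).
Qed.

Let int_diff q : \int[P]_w (q * \1_A w - X w * \1_A w) = a * q - a * CVaR a P X.
Proof.
rewrite RintegralB// -aCVaR; congr (_ - _).
rewrite RintegralZl//; last by have := iqA 1; under eq_fun do rewrite mul1r.
rewrite mulrC -PA; congr (_ * _).
by rewrite /Rintegral integral_indic// setIT.
Qed.

(** Since [A] has probability [a], the integral of [q - X] over [A] is [a * (q - CVaR)]; pointwise
    [(q - X) * \1_A] is at most [Num.max (q - X) 0]. *)
Lemma CVaR_ge q : q - a^-1 * \int[P]_w Num.max (q - X w) 0 <= CVaR a P X.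
Proof.
have a0 : 0 < a by case/andP : a01.
rewrite lerBlDl -lerBlDr -(ler_pM2l a0) mulrA divff ?gt_eqF// mul1r mulrBr.
rewrite -int_diff; apply: le_Rintegral => //.
  by have := integrableB measurableT (iqA q) iXA.
move=> w _; rewrite indicE -mulrBl le_max.
by case: (_ \in _); rewrite ?mulr1 ?mulr0 lexx ?orbT.
Qed.

(** At [q = nu] the pointwise inequality behind [CVaR_ge] is an equality, because [A] is exactly the
    set where [nu - X] is nonnegative. *)
Lemma CVaR_VaR :
  CVaR a P X = VaR a P X - a^-1 * \int[P]_w Num.max (VaR a P X - X w) 0.
Proof.
have a0 : 0 < a by case/andP : a01.
rewrite -/nu; suff -> : \int[P]_w Num.max (nu - X w) 0 = a * nu - a * CVaR a P X.
  by rewrite mulrBr !mulKf ?gt_eqF// subKr.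
rewrite -int_diff; apply: eq_Rintegral => w _; rewrite indicE -mulrBl.
have [/set_mem wA|/negP wA] := boolP (w \in A).
  by rewrite mulr1; apply/max_idPl; rewrite subr_ge0.
rewrite mulr0; apply/max_idPr; rewrite subr_le0 leNgt; apply/negP => /ltW Xn.
by apply: wA; rewrite inE.
Qed.

End value_at_risk.

(** * Linear growth of the c.d.f. around a point of positive density *)

Section density_growth.
Context d (Omega : measurableType d) (R : realType) (P : probability Omega R).
Variables (X : {mfun Omega >-> R}) (f : R -> R).
Hypothesis Xf : is_pdf P X f.

Local Notation F z := (fine (cdf (P := P) X z)).

Lemma cdf_sub_ge (p q c : R) : p <= q -> 0 <= c ->
  (forall x, p < x <= q -> c <= f x) -> c * (q - p) <= F q - F p.
Proof.
move=> pq c0 cf; have [mf f0 hf] := Xf.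
have Fpq : (cdf (P := P) X q = cdf (P := P) X p + distribution P X `]p, q])%E.
  rewrite /cdf -measureU//; last first.
    apply/seteqP; split => // x [] /=; rewrite !in_itv/= => xp /andP[px _].
    by have := lt_le_trans px xp; rewrite ltxx.
  congr (distribution P X _); apply/seteqP; split => x /=; rewrite !in_itv/=.
    by move=> xq; case: (leP x p) => xp; [left|right].
  by case=> [xp|/andP[]//]; exact: le_trans pq.
have h : ((c * (q - p))%:E <= distribution P X `]p, q])%E.
  rewrite hf//.
  have -> : (c * (q - p))%:E = (\int[lebesgue_measure]_(z in `]p, q]) (cst c%:E z))%E.
    rewrite integral_cst//= lebesgue_measure_itv/= lte_fin.
    case: ltgtP pq => // ->.
    by rewrite subrr mulr0 mule0.
  apply: ge0_le_integral => //.
  - by apply/measurable_EFinP; exact: measurable_funTS.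
have -> : F q = F p + fine (distribution P X `]p, q]).
  by rewrite Fpq fineD// fin_num_measure.
by rewrite [leRHS]addrAC subrr add0r -lee_fin fineK// fin_num_measure.
Qed.

(** Within distance [e2] of [nu] the density is at least [f nu / 2]. Farther out, up to [D],
    monotonicity keeps the increment reached at [e2], at the price of a smaller slope. *)
Lemma cdf_growth (nu D : R) : {for nu, continuous f} -> 0 < f nu -> 0 <= D ->
  exists2 c, 0 < c & forall t, 0 <= t <= D ->
    F nu + c * t <= F (nu + t) /\ F (nu - t) + c * t <= F nu.
Proof.
move=> cf fnu D0; have [_ f0 _] := Xf.
pose c0 := f nu / 2.
have c00 : 0 < c0 by rewrite divr_gt0.
have /nbhs_ballP[e /= e0 he] : nbhs nu [set x | c0 < f x].
  by apply: (cvgr_gt (f nu) cf); rewrite /c0; lra.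
pose e2 := e / 2.
have e20 : 0 < e2 by rewrite divr_gt0.
have hc x : `|nu - x| <= e2 -> c0 <= f x.
  by move=> xe; apply/ltW/he; rewrite /ball/=; apply: le_lt_trans xe _; rewrite /e2; lra.
have F_nd p q : p <= q -> F p <= F q.
  by move=> pq; have := @cdf_sub_ge p q 0 pq (lexx _) (fun x _ => f0 x); rewrite mul0r subr_ge0.
have h t : 0 <= t <= e2 -> F nu + c0 * t <= F (nu + t) /\ F (nu - t) + c0 * t <= F nu.
  move=> /andP[t0 te]; split.
    have := @cdf_sub_ge nu (nu + t) c0; rewrite lerDl addrAC subrr add0r => /(_ t0 (ltW c00)).
    rewrite lerBrDl; apply => x /andP[nx xt]; apply: hc.
    by rewrite ler0_norm; lra.
  have := @cdf_sub_ge (nu - t) nu c0; rewrite gerBl subKr => /(_ t0 (ltW c00)).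
  rewrite lerBrDl; apply => x /andP[nx xt]; apply: hc.
  by rewrite ger0_norm; lra.
have De : 0 < D + e2 by rewrite ltr_wpDl.
(* For [0 <= t <= D] the factor makes [e2 / (D + e2) * t] at most [t] and at most [e2], which serve
   the near and the far range. The term [e2] in the denominator keeps it positive when [D = 0]. *)
exists (c0 * (e2 / (D + e2))).
  by rewrite mulr_gt0// divr_gt0.
move=> t /andP[t0 tD].
have r1 : e2 / (D + e2) * t <= t /\ e2 / (D + e2) * t <= e2.
  have := e20; split; rewrite mulrAC ler_pdivrMr//; nra.
have [te|/ltW et] := leP t e2.
  have [|h1 h2] := h t; first by rewrite t0.
  by move: r1 => [r1 _]; rewrite -mulrA; split; nra.
have [|h1 h2] := h e2; first by rewrite (ltW e20)/=.
have k1 : F (nu + e2) <= F (nu + t) by rewrite F_nd// lerD2l.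
have k2 : F (nu - t) <= F (nu - e2) by rewrite F_nd// lerD2l lerN2.
by move: r1 => [_ r1]; rewrite -mulrA; split; nra.
Qed.

End density_growth.

(** * The empirical quantile *)

Section empirical_quantile.
Context (R : realType) (N : nat).
Implicit Types (v : 'I_N -> R) (a z q : R).

Lemma empirical_cdf_nd v z z' : z <= z' -> empirical_cdf v z <= empirical_cdf v z'.
Proof.
move=> zz; rewrite ler_wpM2l ?invr_ge0//; apply: ler_sum => i _.
by rewrite ler_nat; case: (leP (v i) z) => // /le_trans/(_ zz) ->.
Qed.

Lemma empirical_cdf_ge1 v z : (0 < N)%N -> (forall i, v i <= z) ->
  empirical_cdf v z = 1.
Proof.
move=> N0 vz; rewrite /empirical_cdf (eq_bigr (fun=> 1)) => [|i _]; last by rewrite vz.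
by rewrite sumr_const card_ord mulVf// pnatr_eq0 -lt0n.
Qed.

Lemma empirical_cdf_le0 v z : (forall i, z < v i) -> empirical_cdf v z = 0.
Proof.
by move=> vz; rewrite /empirical_cdf big1 ?mulr0// => i _; rewrite leNgt vz.
Qed.

(** The infimum is attained because the empirical c.d.f. is a right-continuous step function. The
    resulting equivalence turns every question about the empirical quantile into one about the
    empirical c.d.f. *)
Lemma empirical_VaR_le a v z : (0 < N)%N -> 0 < a <= 1 ->
  (empirical_VaR a v <= z) = (a <= empirical_cdf v z).
Proof.
move=> N0 /andP[a0 a1]; pose S := [set z | a <= empirical_cdf v z].
have vb i : `|v i| <= \sum_j `|v j|.
  by rewrite (bigD1 i)//= lerDl sumr_ge0.
have lbS : lbound S (- \sum_j `|v j|).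
  move=> x /= ax; rewrite leNgt; apply/negP => xb.
  suff : empirical_cdf v x = 0 by move=> F0; move: ax; rewrite /S/= F0 leNgt a0.
  apply: empirical_cdf_le0 => i; apply: lt_le_trans xb _.
  by rewrite lerNl (le_trans _ (vb i))// -normrN ler_norm.
have infS : has_inf S.
  split; last by exists (- \sum_j `|v j|).
  exists (\sum_j `|v j|); rewrite /S/= empirical_cdf_ge1// => i.
  exact: le_trans (ler_norm _) (vb i).
apply/idP/idP => [qz|az]; last by apply: ge_inf => //; case: infS.
apply: le_trans (empirical_cdf_nd v qz).
set q := empirical_VaR a v.
(* The gap between [q] and the next sample value above it, capped at 1: a point [x < q + e] has no
   sample value in []q, x]], so the empirical c.d.f. at [x] is at most that at [q]. *)
pose e := \big[Num.min/1]_(i | q < v i) (v i - q).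
have e0 : 0 < e by apply: lt_bigmin => // i; rewrite subr_gt0.
have [x Sx xqe] := inf_adherent e0 infS.
apply: le_trans Sx _; rewrite ler_wpM2l ?invr_ge0//; apply: ler_sum => i _.
rewrite ler_nat; case: (leP (v i) q) => [_|qi]; first by case: (_ <= _).
suff : ~~ (v i <= x) by move=> /negbTE ->.
rewrite -ltNge (lt_le_trans xqe)// -lerBrDl.
exact: (bigmin_le_cond _ (fun i => v i - q)).
Qed.

Lemma empirical_VaR_norm_le a v M : (0 < N)%N -> 0 < a <= 1 ->
  (forall i, `|v i| <= M) -> `|empirical_VaR a v| <= M.
Proof.
move=> N0 a01 vM; rewrite ler_norml; apply/andP; split; last first.
  rewrite empirical_VaR_le// empirical_cdf_ge1//; first by case/andP: a01.
  by move=> i; exact: le_trans (ler_norm _) (vM i).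
rewrite leNgt; apply/negP => qM.
have := lexx (empirical_VaR a v); rewrite empirical_VaR_le// empirical_cdf_le0 => [|i].
  by case/andP: a01 => a0 _; rewrite leNgt a0.
by apply: lt_le_trans qM _; rewrite lerNl (le_trans _ (vM i))// -normrN ler_norm.
Qed.

(** A quantile above [nu + t] means that the empirical c.d.f. at [nu + t] is below [a], hence at
    least [c * t] below [F]; a quantile below [nu - t] forces the opposite deviation at [nu - t].
    The sum of squares covers both cases and prepares Chebyshev's inequality. *)
Lemma quantile_deviation v (F : R -> R) a nu c M t : (0 < N)%N -> 0 < a <= 1 ->
  (forall i, `|v i| <= M) -> `|nu| <= M -> F nu = a -> 0 < c ->
  (forall t, 0 <= t <= 2 * M ->
    F nu + c * t <= F (nu + t) /\ F (nu - t) + c * t <= F nu) ->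
  0 < t -> t < `|empirical_VaR a v - nu| ->
  (c * t) ^+ 2 <= (empirical_cdf v (nu + t) - F (nu + t)) ^+ 2 +
                  (empirical_cdf v (nu - t) - F (nu - t)) ^+ 2.
Proof.
move=> N0 a01 vM nuM Fnu c0 hF t0 tq.
have qM := empirical_VaR_norm_le N0 a01 vM.
have tM : t <= 2 * M.
  rewrite ltW// (lt_le_trans tq)// (le_trans (ler_normB _ _))//.
  by rewrite mulr2n mulrDl mul1r lerD.
have [|hu hl] := hF t; first by rewrite (ltW t0).
have ct : 0 < c * t by rewrite mulr_gt0.
move: tq; rewrite lter_normr => /orP[tq|tq].
- have : empirical_cdf v (nu + t) < a.
    by rewrite ltNge -empirical_VaR_le// -ltNge; lra.
  move=> h; apply: ler_wpDr; first exact: sqr_ge0.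
  nra.
- have : a <= empirical_cdf v (nu - t).
    by rewrite -empirical_VaR_le//; lra.
  move=> h; apply: ler_wpDl; first exact: sqr_ge0.
  nra.
Qed.

End empirical_quantile.

(** Doubling the cap from [2 ^+ K] raises the left side by at most [2 ^+ K], and only if [z] exceeds
    [2 ^+ K]. *)
Lemma dyadic_bound (R : realType) (z : R) K : 0 <= z ->
  Num.min z (2 ^+ K) <= 1 + \sum_(k < K) 2 ^+ k * (2 ^+ k < z)%R%:R.
Proof.
move=> z0; elim: K => [|K IH]; first by rewrite big_ord0 addr0 expr0 ge_min lexx orbT.
rewrite big_ord_recr/= addrA; set s := 1 + _ in IH *.
have p0 : 0 < (2 : R) ^+ K by rewrite exprn_gt0.
have [kz|zk] := ltP (2 ^+ K) z.
  rewrite mulr1 ge_min exprS mulr2n mulrDl mul1r lerD2r.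
  by move: IH; rewrite ge_min leNgt => /orP[|->]; rewrite ?orbT//; lra.
by rewrite mulr0 addr0; move: IH; rewrite !ge_min => /orP[->//|]; lra.
Qed.

Lemma sum_half_pow_le2 (R : realType) K : \sum_(k < K) (2 ^+ k)^-1 <= 2 :> R.
Proof.
suff -> : \sum_(k < K) (2 ^+ k)^-1 = 2 - 2 * (2 ^+ K)^-1 :> R.
  by rewrite gerBl mulr_ge0// invr_ge0 exprn_ge0.
elim: K => [|K IH]; first by rewrite big_ord0 expr0 invr1 mulr1 subrr.
rewrite big_ord_recr/= IH exprS invfM.
by field; rewrite expf_neq0// pnatr_eq0.
Qed.

(** * Mean absolute error of the empirical quantile *)

Section quantile_concentration.
Context d (T : measurableType d) (R : realType) (Q : probability T R) (N : nat).
Variables (V : 'I_N -> T -> R) (F : R -> R) (a M : R).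
Hypotheses (N0 : (0 < N)%N) (a01 : 0 < a <= 1).
Hypotheses (mV : forall i, measurable_fun setT (V i)) (VM : forall i w, `|V i w| <= M).
Hypothesis VF : forall i z, Q [set w | V i w <= z] = (F z)%:E.
Hypothesis VF2 : forall i j z, i != j ->
  Q ([set w | V i w <= z] `&` [set w | V j w <= z]) = (F z * F z)%:E.

Let ind i z w : R := (V i w <= z)%R%:R.

Let indE i z : ind i z = \1_[set w | V i w <= z].
Proof.
apply/funext => w; rewrite indicE /ind; congr (nat_of_bool _)%:R.
by apply/idP/idP; rewrite inE.
Qed.

Let mS i z : measurable [set w | V i w <= z].
Proof.
rewrite (_ : [set w | _] = V i @^-1` `]-oo, z]); last first.
  by apply/seteqP; split => w /=; rewrite in_itv.
by rewrite -[X in measurable X]setTI; exact: mV.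
Qed.

Let mind i z : measurable_fun setT (ind i z).
Proof. by rewrite indE; exact: measurable_indic. Qed.

Let ind01 i z w : 0 <= ind i z w <= 1.
Proof. by rewrite /ind; case: (V i w <= z); rewrite ?lexx ?ler01. Qed.

Let F01 z : 0 <= F z <= 1.
Proof.
have i0 : 'I_N by exact: Ordinal N0.
apply/andP; split; rewrite -lee_fin -(VF i0); first exact: measure_ge0.
by apply: probability_le1; exact: mS.
Qed.

Let int_ind i z : \int[Q]_w ind i z w = F z.
Proof.
by rewrite /Rintegral indE integral_indic// setIT; exact: (congr1 fine (VF i z)).
Qed.

Let int_ind2 i j z : i != j -> \int[Q]_w (ind i z w * ind j z w) = F z * F z.
Proof.
move=> ij; rewrite (_ : (fun w => _) =
    \1_([set w | V i w <= z] `&` [set w | V j w <= z])); last first.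
  by rewrite !indE indicI.
rewrite /Rintegral integral_indic//; last exact: measurableI.
by rewrite setIT; exact: (congr1 fine (VF2 z ij)).
Qed.

Lemma measurable_empirical_cdf z :
  measurable_fun setT (fun w => empirical_cdf (fun i => V i w) z).
Proof.
apply: measurable_funM => //.
by apply: measurable_sum => i; exact: mind.
Qed.

(** By [empirical_VaR_le], the event that the quantile exceeds [z] is the event that the empirical
    c.d.f. at [z] is below [a]. *)
Lemma measurable_empirical_VaR :
  measurable_fun setT (fun w => empirical_VaR a (fun i => V i w)).
Proof.
move=> mT; apply: (measurability _ (RGenOInfty.measurableE R)) => //.
move=> _ [_ [z ->] <-]; rewrite setTI.
rewrite (_ : _ @^-1` _ = (fun w => empirical_cdf (fun i => V i w) z) @^-1` `]-oo, a[).
  by rewrite -[X in measurable X]setTI; exact: measurable_empirical_cdf.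
apply/seteqP; split => w /=; rewrite !in_itv/= andbT.
  by rewrite !ltNge empirical_VaR_le.
by rewrite !ltNge empirical_VaR_le.
Qed.

Let X i z w := ind i z w - F z.

Let mX i z : measurable_fun setT (X i z).
Proof. exact: measurable_funB. Qed.

Let X1 i z w : `|X i z w| <= 1.
Proof.
by have := ind01 i z w; have := F01 z; rewrite /X ler_norml; lra.
Qed.

Let iXX i j z : Q.-integrable setT (EFin \o (fun w => X i z w * X j z w)).
Proof.
apply: (@bounded_integrable _ _ _ _ _ 1); first exact: measurable_funM.
by move=> w; rewrite normrM mulr_ile1.
Qed.

Let int_XX i j z : i != j -> \int[Q]_w (X i z w * X j z w) = 0.
Proof.
move=> ij.
have b i' : Q.-integrable setT (EFin \o (fun w => F z * ind i' z w)).
  apply: (@bounded_integrable _ _ _ _ _ 1); first exact: measurable_funM.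
  move=> w; have /andP[f0 f1] := F01 z; have /andP[i0 i1] := ind01 i' z w.
  by rewrite ger0_norm ?mulr_ge0// mulr_ile1.
have b2 : Q.-integrable setT (EFin \o (fun w => ind i z w * ind j z w)).
  apply: (@bounded_integrable _ _ _ _ _ 1); first exact: measurable_funM.
  move=> w; have /andP[f0 f1] := ind01 i z w; have /andP[i0 i1] := ind01 j z w.
  by rewrite ger0_norm ?mulr_ge0// mulr_ile1.
have bi i' : Q.-integrable setT (EFin \o ind i' z).
  apply: (@bounded_integrable _ _ _ _ _ 1) => // w.
  by have /andP[f0 f1] := ind01 i' z w; rewrite ger0_norm.
have c : Q.-integrable setT (EFin \o cst (F z * F z)).
  exact: finite_measure_integrable_cst.
transitivity (\int[Q]_w ((ind i z w * ind j z w - F z * ind i z w) +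
    (F z * F z - F z * ind j z w))).
  by apply: eq_Rintegral => w _; rewrite /X; ring.
rewrite RintegralD//; last 2 first.
- by have := integrableB measurableT b2 (b i).
- by have := integrableB measurableT c (b j).
rewrite RintegralB// int_ind2// RintegralZl// int_ind RintegralB//.
rewrite (RintegralZl _ measurableT (bi j)) int_ind Rintegral_probability_cst.
by rewrite !subrr addr0.
Qed.

Let DE z w : (empirical_cdf (fun i => V i w) z - F z) ^+ 2 =
  N%:R ^- 2 * \sum_i \sum_j X i z w * X j z w.
Proof.
have Nn0 : N%:R != 0 :> R by rewrite pnatr_eq0 -lt0n.
under eq_bigr do rewrite -mulr_sumr.
rewrite -mulr_suml -expr2 -exprVn -exprMn; congr (_ ^+ 2).
by rewrite sumrB sumr_const card_ord mulrBr -(mulr_natl (F z)) mulKf.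
Qed.

(** Pairwise independence kills the off-diagonal terms of the expanded square; each of the [N]
    diagonal terms is at most 1, against the factor [N%:R ^- 2]. *)
Lemma empirical_cdf_variance z :
  \int[Q]_w (empirical_cdf (fun i => V i w) z - F z) ^+ 2 <= N%:R^-1.
Proof.
have N0' : 0 < N%:R :> R by rewrite ltr0n.
under eq_Rintegral do rewrite DE.
have iS i : Q.-integrable setT (EFin \o (fun w => \sum_j X i z w * X j z w)).
  by apply: integrable_Rsum => j; exact: iXX.
rewrite RintegralZl//; last by apply: integrable_Rsum => i; exact: iS.
rewrite Rintegral_sum//.
under eq_bigr do rewrite Rintegral_sum//.
under eq_bigr => i _.
  rewrite (bigD1 i)//= big1 ?addr0; last by move=> j ji; rewrite int_XX// eq_sym.
  over.
rewrite -exprVn expr2 -mulrA ler_piMr ?invr_ge0 ?ler0n//.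
rewrite mulrC ler_pdivrMr// mul1r.
apply: (@le_trans _ _ (\sum_(i < N) 1)); last by rewrite sumr_const card_ord.
apply: ler_sum => i _.
apply: (@le_trans _ _ (\int[Q]_w 1)); last by rewrite Rintegral_probability_cst.
apply: le_Rintegral => //; first exact: finite_measure_integrable_cst.
by move=> w _; rewrite -expr2 -real_normK ?num_real// expr_le1.
Qed.

Lemma integrable_empirical_cdf_sqr z : Q.-integrable setT
  (EFin \o (fun w => (empirical_cdf (fun i => V i w) z - F z) ^+ 2)).
Proof.
under eq_fun do rewrite /= DE.
have := integrableZl measurableT (N%:R ^- 2) (integrable_Rsum (index_enum _)
  (fun i => integrable_Rsum (index_enum _) (fun j => iXX i j z))).
by under eq_fun do rewrite -EFinM.
Qed.

Lemma integrable_empirical_VaR_dist nu : Q.-integrable setT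
  (EFin \o (fun w => `|empirical_VaR a (fun i => V i w) - nu|)).
Proof.
apply: (@bounded_integrable _ _ _ _ _ (M + `|nu|)).
  apply: measurableT_comp => //; apply: measurable_funB => //.
  exact: measurable_empirical_VaR.
move=> w; rewrite normr_id (le_trans (ler_normB _ _))// lerD2r.
exact: empirical_VaR_norm_le.
Qed.

Lemma quantile_error nu c : `|nu| <= M -> F nu = a -> 0 < c ->
  (forall t, 0 <= t <= 2 * M ->
    F nu + c * t <= F (nu + t) /\ F (nu - t) + c * t <= F nu) ->
  \int[Q]_w `|empirical_VaR a (fun i => V i w) - nu| <=
  (1 + 4 / c ^+ 2) * (Num.sqrt N%:R)^-1.
Proof.
move=> nuM Fnu c0 hF.
pose Z w := `|empirical_VaR a (fun i => V i w) - nu|.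
have iZ : Q.-integrable setT (EFin \o Z) by exact: integrable_empirical_VaR_dist.
rewrite -/(Z _); set s := Num.sqrt N%:R.
have s0 : 0 < s by rewrite sqrtr_gt0 ltr0n.
have s2 : s ^+ 2 = N%:R by rewrite sqr_sqrtr// ler0n.
have ZM w : s * Z w <= s * (2 * M).
  rewrite ler_wpM2l ?(ltW s0)// (le_trans (ler_normB _ _))// mulr2n mulrDl mul1r.
  by rewrite lerD// empirical_VaR_norm_le.
(* Chosen so that [2 ^+ K] dominates the scaled error [s * Z], which makes the minimum in
   [dyadic_bound] equal to [s * Z] itself. *)
pose K := Num.bound (s * (2 * M)).
have KM w : s * Z w <= 2 ^+ K.
  apply: le_trans (ZM w) _; apply: (@le_trans _ _ K%:R).
    apply/ltW/archi_boundP/(le_trans _ (ZM point)).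
    exact: mulr_ge0 (ltW s0) (normr_ge0 _).
  by rewrite -natrX ler_nat ltnW// ltn_expl.
pose D z w := (empirical_cdf (fun i => V i w) z - F z) ^+ 2.
(* The dyadic weight divided by the lower bound of [quantile_deviation] at [t k]: whenever [s * Z]
   exceeds [2 ^+ k], the [k]-th term below is at least [2 ^+ k]. *)
pose B k := 2 ^+ k / (c * (2 ^+ k / s)) ^+ 2.
pose t k := 2 ^+ k / s.
have p0 k : 0 < (2 : R) ^+ k by rewrite exprn_gt0.
have t0 k : 0 < t k by rewrite divr_gt0.
have B0 k : 0 <= B k by rewrite divr_ge0 ?sqr_ge0// ltW.
have step w : s * Z w <= 1 + \sum_(k < K) B k * (D (nu + t k) w + D (nu - t k) w).
  have /min_idPl <- := KM w.
  apply: le_trans (dyadic_bound _ _) _; first exact: mulr_ge0 (ltW s0) (normr_ge0 _).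
  rewrite lerD2l; apply: ler_sum => k _.
  have [kz|_] := boolP (_ < _); last first.
    by rewrite mulr0 mulr_ge0// addr_ge0//; exact: sqr_ge0.
  rewrite mulr1 /B -mulrA ler_peMr ?(ltW (p0 _))//.
  have ct0 : 0 < (c * (2 ^+ k / s)) ^+ 2 by rewrite exprn_gt0// mulr_gt0//; exact: t0.
  rewrite mulrC ler_pdivlMr// mul1r.
  apply: (quantile_deviation N0 a01 (fun i => VM i w) nuM Fnu c0 hF (t0 k)).
  by rewrite /t ltr_pdivrMr// mulrC.
have iD z : Q.-integrable setT (EFin \o D z) by exact: integrable_empirical_cdf_sqr.
have iBD k : Q.-integrable setT
    (EFin \o (fun w => B k * (D (nu + t k) w + D (nu - t k) w))).
  have := integrableZl measurableT (B k)
    (integrableD measurableT (iD (nu + t k)) (iD (nu - t k))).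
  by under eq_fun do rewrite /= -EFinD -EFinM.
have iS : Q.-integrable setT
    (EFin \o (fun w => \sum_(k < K) B k * (D (nu + t k) w + D (nu - t k) w))).
  exact: integrable_Rsum.
have i1 : Q.-integrable setT (EFin \o cst (1 : R)).
  exact: finite_measure_integrable_cst.
rewrite ler_pdivlMr// mulrC -RintegralZl//.
apply: (@le_trans _ _ (\int[Q]_w (1 +
    \sum_(k < K) B k * (D (nu + t k) w + D (nu - t k) w)))).
  apply: le_Rintegral => //.
    have := integrableZl measurableT s iZ.
    by under eq_fun do rewrite -EFinM.
  by have := integrableD measurableT i1 iS.
  by move=> w _; exact: step.
rewrite [leLHS](RintegralD measurableT i1 iS) Rintegral_probability_cst lerD2l.
rewrite Rintegral_sum//.
(* Since [s ^+ 2 = N], the coefficient [B k] is [N / (c ^+ 2 * 2 ^+ k)], and the two variances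
   contribute at most [2 / N]. The geometric series then gives [4 / c ^+ 2], independently of
   [K]. *)
apply: (@le_trans _ _ (\sum_(k < K) (2 / c ^+ 2) * (2 ^+ k)^-1)); last first.
  rewrite -mulr_sumr (_ : 4 = 2 * 2); last by rewrite -natrM.
  rewrite [leRHS]mulrAC ler_wpM2l ?sum_half_pow_le2//.
  by rewrite divr_ge0// sqr_ge0.
apply: ler_sum => k _.
have iDD : Q.-integrable setT (EFin \o (fun w => D (nu + t k) w + D (nu - t k) w)).
  by have := integrableD measurableT (iD (nu + t k)) (iD (nu - t k)).
rewrite RintegralZl// RintegralD//.
have -> : 2 / c ^+ 2 * (2 ^+ k)^-1 = B k * (N%:R^-1 + N%:R^-1).
  rewrite /B -s2; field.
  by rewrite !gt_eqF.
by rewrite ler_wpM2l// lerD// empirical_cdf_variance.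
Qed.

End quantile_concentration.

(** * The gradient of CVaR *)

Section likelihood_ratio.
Context (R : realType) (n k : nat) (YT : Type) (b : R).
Variables (fY : 'rV[R]_k -> YT -> R) (fXY : 'rV[R]_k -> n.-tuple R -> YT -> R).
Variables (j : 'I_k) (M1 M2 : R).
Hypotheses (fY_gt0 : forall theta y, 0 < fY theta y)
  (fY_derivable : forall theta y, has_partial j (fun t => ln (fY t y)) theta)
  (fY_bounded : forall theta y, `|partial j (fun t => ln (fY t y)) theta| <= M1)
  (fXY_gt0 : forall theta x y, cube b x -> 0 < fXY theta x y)
  (fXY_derivable : forall theta x y, cube b x ->
     has_partial j (fun t => ln (fXY t x y)) theta)
  (fXY_bounded : forall theta x y, cube b x ->
     `|partial j (fun t => ln (fXY t x y)) theta| <= M2).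
Variable theta : 'rV[R]_k.

Definition loglik t x y := ln (fY t y) + ln (fXY t x y).

Local Notation shifted h := (h *: delta_mx ord0 j + theta).

(** The exponential form is nonnegative for every [x], and it reduces derivatives and bounds to
    those of the log-densities. *)
Definition likelihood_ratio h x y := expR (loglik (shifted h) x y - loglik theta x y).

Lemma likelihood_ratioE h x y : cube b x ->
  fY (shifted h) y * fXY (shifted h) x y =
  likelihood_ratio h x y * (fY theta y * fXY theta x y).
Proof.
move=> bx; have L t : fY t y * fXY t x y = expR (loglik t x y).
  by rewrite expRD !lnK// posrE ?fXY_gt0.
by rewrite !L -expRD subrK.
Qed.

Lemma is_derive_likelihood_ratio x y : cube b x ->
  is_derive (0 : R) 1 (fun h => likelihood_ratio h x y)
    (score fY fXY j theta x y).
Proof.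
move=> bx.
have s0 : shifted 0 = theta by rewrite scale0r add0r.
have d1 := @is_derive_line _ _ (fun t => ln (fY t y)) theta (delta_mx ord0 j) 0
  (@fY_derivable _ _).
have d2 := @is_derive_line _ _ (fun t => ln (fXY t x y)) theta (delta_mx ord0 j) 0
  (@fXY_derivable _ _ _ bx).
have d3 : is_derive (0 : R) 1 (fun h => loglik (shifted h) x y - loglik theta x y)
    (score fY fXY j theta x y).
  apply: (is_derive_eq (is_deriveB (is_deriveD d1 d2)
    (is_derive_cst (loglik theta x y) (0 : R) (1 : R)))).
  by rewrite subr0 /score /partial -/(shifted 0) s0.
have := is_derive1_comp (is_derive_expR _) d3.
by rewrite s0 subrr expR0 mul1r.
Qed.

Lemma score_norm_le x y : cube b x -> `|score fY fXY j theta x y| <= M1 + M2.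
Proof.
by move=> bx; rewrite (le_trans (ler_normD _ _))// lerD// fXY_bounded.
Qed.

Lemma loglik_lipschitz h x y : cube b x ->
  `|loglik (shifted h) x y - loglik theta x y| <= (M1 + M2) * `|h|.
Proof.
move=> bx.
have l1 := derive_bounded_lipschitz (fun t => @fY_derivable t y)
  (fun t => fY_bounded t y) theta h.
have l2 := derive_bounded_lipschitz (fun t => @fXY_derivable t x y bx)
  (fun t => fXY_bounded t y bx) theta h.
rewrite /loglik opprD addrACA (le_trans (ler_normD _ _))// mulrDl.
exact: lerD l1 l2.
Qed.

(** The dominating constant for differentiation under the integral. The log-likelihood is Lipschitz
    in [h], so [expRB1_le] yields a factor [h], which cancels, and an exponential that [|h| <= 1]
    keeps bounded. *)
Lemma likelihood_ratio_quotient_le h x y : cube b x -> h != 0 -> `|h| <= 1 ->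
  `|h^-1 * (likelihood_ratio h x y - 1)| <= (M1 + M2) * expR (M1 + M2).
Proof.
move=> bx h0 h1; have C0 := le_trans (normr_ge0 _) (score_norm_le y bx).
have l := loglik_lipschitz h y bx.
rewrite normrM normfV ler_pdivrMl ?normr_gt0//.
apply: le_trans (expRB1_le _) _; rewrite mulrCA mulrA.
apply: ler_pM => //.
by rewrite ler_expR (le_trans l)// -[leRHS]mulr1 ler_wpM2l.
Qed.

Lemma measurable_likelihood_ratio h y :
  (forall t, measurable_fun (cube b) (fun x => fXY t x y)) ->
  measurable_fun (cube b) (fun x => likelihood_ratio h x y).
Proof.
move=> mf; have ml t : measurable_fun (cube b) (fun x => loglik t x y).
  by apply: measurable_funD => //; exact: measurableT_comp.
by apply: measurableT_comp => //; exact: measurable_funB.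
Qed.

(** On the cube the score is the pointwise limit of measurable difference quotients of the
    likelihood ratio along [harmonic]. *)
Lemma measurable_score y :
  (forall t, measurable_fun (cube b) (fun x => fXY t x y)) ->
  measurable_fun (cube b) (fun x => score fY fXY j theta x y).
Proof.
move=> mf; have n0 m : (harmonic m : R) != 0 by rewrite gt_eqF// harmonic_gt0.
apply: (@measurable_fun_cvg _ _ _ _
  (fun m x => (harmonic m)^-1 * (likelihood_ratio (harmonic m) x y - 1))).
  move=> m; apply: measurable_funM => //; apply: measurable_funB => //.
  exact: measurable_likelihood_ratio.
move=> x bx; have := derive_cvg_seq (is_derive_likelihood_ratio y bx) n0 cvg_harmonic.
rewrite [likelihood_ratio 0 _ _]/likelihood_ratio scale0r add0r subrr expR0.
by under eq_fun do rewrite addr0.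
Qed.

End likelihood_ratio.

(** * The gradient formula by the envelope argument *)

Section CVaR_gradient.
Context (R : realType) (n k : nat) (a b : R) (dY : measure_display)
  (YT : measurableType dY) (d : measure_display) (Omega : measurableType d).
Hypotheses (a01 : 0 < a < 1) (YTc : countable [set: YT])
  (YT1 : forall y : YT, measurable [set y]).
Variables (P : 'rV[R]_k -> probability Omega R)
  (X : {mfun Omega >-> n.-tuple R}) (Y : {mfun Omega >-> YT}).
Hypothesis X_cube : forall w, cube b (X w).
Variables (fY : 'rV[R]_k -> YT -> R) (fXY : 'rV[R]_k -> n.-tuple R -> YT -> R).
Hypotheses (fY_pmf : forall theta, is_pmf (P theta) Y (fY theta))
  (fXY_pdf : forall theta, is_cond_pdf (P theta) b X Y (fXY theta)).
Variables (r : n.-tuple R -> YT -> R) (M : R) (Rv : {mfun Omega >-> R}).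
Hypotheses (mr : forall y, measurable_fun (cube b) (r ^~ y))
  (rM : forall x y, cube b x -> `|r x y| <= M)
  (RvE : forall w, Rv w = r (X w) (Y w))
  (cRv : forall theta, continuous (cdf (P := P theta) Rv)).
Variables (j : 'I_k) (M1 M2 : R).
Hypotheses
  (CVaR_derivable : forall theta, has_partial j (fun t => CVaR a (P t) Rv) theta)
  (fY_gt0 : forall theta y, 0 < fY theta y)
  (fY_derivable : forall theta y, has_partial j (fun t => ln (fY t y)) theta)
  (fY_bounded : forall theta y, `|partial j (fun t => ln (fY t y)) theta| <= M1)
  (fXY_gt0 : forall theta x y, cube b x -> 0 < fXY theta x y)
  (fXY_derivable : forall theta x y, cube b x ->
     has_partial j (fun t => ln (fXY t x y)) theta)
  (fXY_bounded : forall theta x y, cube b x ->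
     `|partial j (fun t => ln (fXY t x y)) theta| <= M2).
Variable theta : 'rV[R]_k.

Let nu := VaR a (P theta) Rv.

Let shortfall x y := Num.max (nu - r x y) 0.

Let mXY : forall (phi : n.-tuple R -> YT -> R),
  (forall y, measurable_fun (cube b) (phi ^~ y)) ->
  measurable_fun setT (fun w => phi (X w) (Y w)).
Proof.
move=> phi mphi; apply: (measurable_fun_countable2 YTc YT1 _ (E := cube b)) => //.
exact: measurable_cube.
Qed.

Let mshortfall y : measurable_fun (cube b) (shortfall ^~ y).
Proof. by apply: measurable_maxr => //; exact: measurable_funB. Qed.

Let shortfall_ge0 x y : 0 <= shortfall x y.
Proof. by rewrite le_max lexx orbT. Qed.

Let shortfall_le x y : cube b x -> shortfall x y <= `|nu| + M.
Proof.
move=> bx; rewrite ge_max; apply/andP; split.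
  by rewrite (le_trans (ler_norm _))// (le_trans (ler_normB _ _))// lerD2l rM.
by rewrite addr_ge0// (le_trans (normr_ge0 _) (rM y bx)).
Qed.

Let mf t y : measurable_fun (cube b) (fun x => fXY t x y).
Proof. by have [] := fXY_pdf t y. Qed.

Lemma partial_CVaR : partial j (fun t => CVaR a (P t) Rv) theta =
  - (a^-1 * \int[P theta]_w (Num.max (nu - Rv w) 0 *
                              score fY fXY j theta (X w) (Y w))).
Proof.
pose v : 'rV[R]_k := delta_mx ord0 j.
have s0 : 0 *: v + theta = theta by rewrite scale0r add0r.
pose L h x y := likelihood_ratio fY fXY j theta h x y.
have L0 x y : L 0 x y = 1 by rewrite /L /likelihood_ratio s0 subrr expR0.
have RvM w : `|Rv w| <= M by rewrite RvE rM.
have mL h y : measurable_fun (cube b) (L h ^~ y).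
  exact: measurable_likelihood_ratio.
have HE h : \int[P (h *: v + theta)]_w Num.max (nu - Rv w) 0 =
    \int[P theta]_w (shortfall (X w) (Y w) * L h (X w) (Y w)).
  rewrite /Rintegral; congr fine.
  transitivity (\int[P (h *: v + theta)]_w (shortfall (X w) (Y w))%:E)%E.
    by apply: eq_integral => w _; rewrite RvE.
  apply: (change_of_measure YTc YT1 X_cube (fY_pmf _) (fY_pmf _) (fXY_pdf _)
    (fXY_pdf _)) => //.
  - by move=> x y _; exact: expR_ge0.
  - by move=> x y bx; exact: (likelihood_ratioE j fY_gt0 fXY_gt0).
pose f h := CVaR a (P (h *: v + theta)) Rv.
(* The minorant of [f] with the quantile frozen at [nu]: [CVaR_ge] gives [H <= f], and [CVaR_VaR]
   gives equality at 0. *)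
pose H h := nu - a^-1 * \int[P (h *: v + theta)]_w Num.max (nu - Rv w) 0.
have df : is_derive (0 : R) 1 f (partial j (fun t => CVaR a (P t) Rv) theta).
  have := @is_derive_line _ _ (fun t => CVaR a (P t) Rv) theta v 0 (@CVaR_derivable _).
  by rewrite s0.
apply: (envelope_derive df (H := H)).
- by move=> h; apply: CVaR_ge RvM _ _.
- by rewrite /H /f s0 (CVaR_VaR a01 RvM (@cRv theta)).
move=> u u0 u1 uc.
(* Under the fixed law [P theta], the difference quotient of [H] is [- a^-1] times the mean of
   [q m]. The [q m] are uniformly bounded and tend to the shortfall times the score. *)
pose q m w := shortfall (X w) (Y w) * ((u m)^-1 * (L (u m) (X w) (Y w) - 1)).
have mS : measurable_fun setT (fun w => shortfall (X w) (Y w)) by exact: mXY.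
have bS w : `|shortfall (X w) (Y w)| <= `|nu| + M.
  by rewrite (ger0_norm (shortfall_ge0 _ _)) shortfall_le.
have mq m : measurable_fun setT (q m).
  apply: measurable_funM => //; apply: measurable_funM => //.
  apply: measurable_funB => //; exact: mXY.
pose C := (M1 + M2) * expR (M1 + M2).
have qC m w : `|q m w| <= (`|nu| + M) * C.
  rewrite normrM ler_pM//.
  exact: (likelihood_ratio_quotient_le fY_derivable fY_bounded fXY_derivable fXY_bounded).
have qs w : q m w @[m --> \oo] -->
    shortfall (X w) (Y w) * score fY fXY j theta (X w) (Y w).
  apply: cvgMr.
  have dL := is_derive_likelihood_ratio fY_derivable fXY_derivable theta (Y w) (X_cube w).
  have := derive_cvg_seq dL u0 uc; rewrite -/(L _ _ _) L0.
  by under eq_fun do rewrite addr0 -/(L _ _ _).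
have HEq m : (u m)^-1 * (H (u m) - H 0) = - (a^-1 * \int[P theta]_w q m w).
  have iq : (P theta).-integrable setT (EFin \o q m).
    by apply: bounded_integrable (qC m) => //; exact: mq.
  have iS : (P theta).-integrable setT (EFin \o (fun w => shortfall (X w) (Y w))).
    exact: bounded_integrable bS.
  have iuq : (P theta).-integrable setT (EFin \o (fun w => u m * q m w)).
    have := integrableZl measurableT (u m) iq.
    by under eq_fun do rewrite -EFinM.
  have eu : \int[P theta]_w (shortfall (X w) (Y w) * L (u m) (X w) (Y w)) =
      \int[P theta]_w shortfall (X w) (Y w) + u m * \int[P theta]_w q m w.
    rewrite -RintegralZl// -RintegralD//; apply: eq_Rintegral => w _.
    by rewrite /q mulrCA mulVKf// mulrBr mulr1 addrC subrK.
  have e0 : \int[P theta]_w (shortfall (X w) (Y w) * L 0 (X w) (Y w)) =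
      \int[P theta]_w shortfall (X w) (Y w).
    by apply: eq_Rintegral => w _; rewrite L0 mulr1.
  rewrite /H !HE eu e0; field.
  by rewrite u0 gt_eqF//; case/andP : a01.
under eq_fun do rewrite HEq.
apply: cvgN; apply: cvgMr.
have -> : (fun w => Num.max (nu - Rv w) 0 * score fY fXY j theta (X w) (Y w)) =
   (fun w => shortfall (X w) (Y w) * score fY fXY j theta (X w) (Y w)).
  by apply/funext => w; rewrite RvE.
apply: (bounded_Rintegral_cvg mq _ qC qs).
apply: measurable_funM => //; apply: mXY => y.
exact: (measurable_score fY_derivable fXY_derivable).
Qed.

End CVaR_gradient.

(** * The bias of the estimator *)

Lemma eq_law_Rintegral d1 d2 dW (T1 : measurableType d1) (T2 : measurableType d2)
    (W : measurableType dW) (R : realType) (P1 : probability T1 R)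
    (P2 : probability T2 R) (S1 : {mfun T1 >-> W}) (S2 : {mfun T2 >-> W})
    (E : set W) (f : W -> R) (K : R) :
  measurable E -> (forall w, E (S1 w)) -> (forall w, E (S2 w)) ->
  measurable_fun E f -> (forall x, E x -> `|f x| <= K) ->
  (forall A, measurable A -> P1 (S1 @^-1` A) = P2 (S2 @^-1` A)) ->
  \int[P1]_w f (S1 w) = \int[P2]_w f (S2 w).
Proof.
move=> mE ES1 ES2 mf fK law.
(* Since [f] is controlled only on [E], its extension by zero is what gets integrated against the
   image laws. *)
pose g := f \_ E.
have mg : measurable_fun setT g by exact/(measurable_restrictT _ mE).
have gE x : E x -> g x = f x by move=> Ex; rewrite /g patchE mem_set.
have transfer d (T : measurableType d) (P : probability T R) (S : {mfun T >-> W}) :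
    (forall w, E (S w)) ->
    (\int[P]_w (f (S w))%:E = \int[distribution P S]_x (g x)%:E)%E.
  move=> ES; rewrite integral_distribution//.
  - by apply: eq_integral => w _; rewrite /= gE.
  - exact/measurable_EFinP.
  - apply: (@bounded_integrable _ _ _ _ (g \o S) K).
      exact: measurableT_comp.
    by move=> w; rewrite /= gE// fK.
rewrite /Rintegral !transfer//; congr fine.
apply: eq_measure_integral => A mA _; exact: law.
Qed.

Section GCVaR_bias.
Context d (T : measurableType d) (R : realType) (Q : probability T R) (N : nat).
Variables (V s : 'I_N -> T -> R) (F : R -> R) (a M Ms nu gamma : R).
Hypotheses (N0 : (0 < N)%N) (a01 : 0 < a <= 1).
Hypotheses (mV : forall i, measurable_fun setT (V i)) (VM : forall i w, `|V i w| <= M).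
Hypotheses (ms : forall i, measurable_fun setT (s i)) (sM : forall i w, `|s i w| <= Ms).
Hypothesis nuM : `|nu| <= M.
Hypothesis int_s : forall i, \int[Q]_w (Num.max (nu - V i w) 0 * s i w) = gamma.

Let q w := empirical_VaR a (fun i => V i w).

(* The i-th summand of the estimator is [- max (q - V i) 0 * s i], which is
   [Ms]-Lipschitz in the quantile [q]. *)
Lemma GCVaR_bias :
  `|\int[Q]_w ((a * N%:R)^-1 *
      \sum_(i < N) s i w * (V i w - q w) * (V i w <= q w)%R%:R) + a^-1 * gamma| <=
  Ms / a * \int[Q]_w `|q w - nu|.
Proof.
have a0 : 0 < a by case/andP : a01.
have NR : 0 < N%:R :> R by rewrite ltr0n.
have M0 : 0 <= M by exact: le_trans (normr_ge0 _) nuM.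
have mq : measurable_fun setT q by exact: measurable_empirical_VaR.
have qM w : `|q w| <= M by exact: empirical_VaR_norm_le.
have Ms0 : 0 <= Ms.
  exact: le_trans (normr_ge0 _) (sM (Ordinal N0) point).
pose c := (a * N%:R)^-1.
have c0 : 0 <= c by rewrite invr_ge0 mulr_ge0// ltW.
(* The estimator with an arbitrary random threshold [p]: [G q] is the estimator itself, and
   [G (cst nu)] has mean exactly [- (a^-1 * gamma)]. *)
pose G (p : T -> R) w := - (c * \sum_(i < N) Num.max (p w - V i w) 0 * s i w).
have mG (p : T -> R) : measurable_fun setT p -> measurable_fun setT (G p).
  move=> mp; apply: measurable_funN; apply: measurable_funM => //.
  apply: measurable_sum => i; apply: measurable_funM => //.
  by apply: measurable_maxr => //; exact: measurable_funB.
have maxb (p : R) i w : `|p| <= M -> `|Num.max (p - V i w) 0| <= 2 * M.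
  move=> pM; rewrite ger0_norm ?le_max ?lexx ?orbT// ge_max mulr_ge0// andbT.
  rewrite (le_trans (ler_norm _))// (le_trans (ler_normB _ _))//.
  by rewrite mulr2n mulrDl mul1r lerD.
have iG (p : T -> R) : measurable_fun setT p -> (forall w, `|p w| <= M) ->
    Q.-integrable setT (EFin \o G p).
  move=> mp pM; apply: (@bounded_integrable _ _ _ _ _ (c * \sum_(i < N) 2 * M * Ms)).
    exact: mG.
  move=> w; rewrite normrN normrM ger0_norm// ler_wpM2l//.
  apply: le_trans (ler_norm_sum _ _ _) _; apply: ler_sum => i _.
  by rewrite normrM ler_pM// maxb.
have Gq w : c * \sum_(i < N) s i w * (V i w - q w) * (V i w <= q w)%R%:R = G q w.
  rewrite /G -mulrN -sumrN; congr (_ * _); apply: eq_bigr => i _.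
  have [Vq|qV] := leP (V i w) (q w).
    by rewrite mulr1 (max_idPl _) ?subr_ge0//; ring.
  by rewrite mulr0 (max_idPr _) ?mul0r ?oppr0// subr_le0 ltW.
have Gnu : \int[Q]_w G (cst nu) w = - (a^-1 * gamma).
  have ims i : Q.-integrable setT (EFin \o (fun w => Num.max (nu - V i w) 0 * s i w)).
    apply: (@bounded_integrable _ _ _ _ _ (2 * M * Ms)).
      apply: measurable_funM => //.
      by apply: measurable_maxr => //; exact: measurable_funB.
    by move=> w; rewrite normrM ler_pM// maxb.
  transitivity (\int[Q]_w ((- c) * \sum_(i < N) Num.max (nu - V i w) 0 * s i w)).
    by apply: eq_Rintegral => w _; rewrite /G mulNr.
  rewrite RintegralZl//; last exact: integrable_Rsum.
  rewrite Rintegral_sum//; under eq_bigr do rewrite int_s.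
  rewrite sumr_const card_ord -(mulr_natl gamma) /c; field.
  by rewrite !gt_eqF.
under eq_Rintegral do rewrite -/c Gq.
rewrite -[a^-1 * _]opprK -Gnu -RintegralB//; try by apply: iG.
have iB : Q.-integrable setT (EFin \o (fun w => G q w - G (cst nu) w)).
  exact: (integrableB measurableT (iG q mq qM)
    (iG (cst nu) (@measurable_cst _ _ _ _ _ _) (fun=> nuM))).
have iD := integrable_empirical_VaR_dist Q N0 a01 mV VM nu.
apply: le_trans (le_normr_Rintegral measurableT iB) _.
rewrite -RintegralZl//; apply: le_Rintegral => //.
- by have := integrable_norm iB.
- have := integrableZl measurableT (Ms / a) iD.
  by under eq_fun do rewrite -EFinM.
move=> w _; rewrite /G -opprD normrN -mulrBr normrM ger0_norm// -sumrB.
have -> : Ms / a * `|q w - nu| = c * \sum_(i < N) (Ms * `|q w - nu|).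
  rewrite sumr_const card_ord -(mulr_natl (Ms * _)) /c; field.
  by rewrite !gt_eqF.
rewrite ler_wpM2l//; apply: le_trans (ler_norm_sum _ _ _) _; apply: ler_sum => i _.
rewrite -mulrBl normrM mulrC ler_pM//=.
(* The positive part is 1-Lipschitz, and [V i w] cancels in the difference of the two arguments. *)
case: (leP (q w - V i w) 0) => h1; case: (leP (nu - V i w) 0) => h2.
- by rewrite subrr normr0.
- by rewrite sub0r normrN gtr0_norm// ler0_norm; lra.
- by rewrite subr0 gtr0_norm// ger0_norm; lra.
- by rewrite opprB addrA subrK.
Qed.

End GCVaR_bias.

Theorem theorem4 (R : realType) (n k : nat) (a b : R)
    (ha : 0 < a < 1) (hb : 0 < b)
    (* the countable (discrete) value space of Y *)
    (dY : measure_display) (YT : measurableType dY)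
    (YT_countable : countable [set: YT])
    (YT_discrete : forall y : YT, measurable [set y])
    (* the random vector (X, Y) under the laws P theta *)
    (d : measure_display) (Omega : measurableType d)
    (P : 'rV[R]_k -> probability Omega R)
    (X : {mfun Omega >-> n.-tuple R}) (Y : {mfun Omega >-> YT})
    (X_cube : forall w, cube b (X w))
    (fY : 'rV[R]_k -> YT -> R)
    (fY_pmf : forall theta, is_pmf (P theta) Y (fY theta))
    (fXY : 'rV[R]_k -> n.-tuple R -> YT -> R)
    (fXY_pdf : forall theta, is_cond_pdf (P theta) b X Y (fXY theta))
    (* the bounded function r, and R = r(X, Y) with its density *)
    (r : n.-tuple R -> YT -> R)
    (r_measurable : forall y, measurable_fun (cube b) (r ^~ y))
    (r_bounded : exists M, forall x y, cube b x -> `|r x y| <= M)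
    (Rv : {mfun Omega >-> R}) (Rv_def : forall w, Rv w = r (X w) (Y w))
    (fR : 'rV[R]_k -> R -> R)
    (fR_pdf : forall theta, is_pdf (P theta) Rv (fR theta))
    (* assumption (1) *)
    (R_continuous : forall theta, continuous (cdf (P := P theta) Rv))
    (VaR_derivable : forall theta j,
       has_partial j (fun t => VaR a (P t) Rv) theta)
    (VaR_bounded : exists M, forall theta j,
       `|partial j (fun t => VaR a (P t) Rv) theta| <= M)
    (CVaR_derivable : forall theta j,
       has_partial j (fun t => CVaR a (P t) Rv) theta)
    (CVaR_bounded : exists M, forall theta j,
       `|partial j (fun t => CVaR a (P t) Rv) theta| <= M)
    (fY_gt0 : forall theta y, 0 < fY theta y)
    (fY_derivable : forall theta j y,
       has_partial j (fun t => ln (fY t y)) theta)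
    (fY_bounded : exists M, forall theta j y,
       `|partial j (fun t => ln (fY t y)) theta| <= M)
    (fXY_gt0 : forall theta x y, cube b x -> 0 < fXY theta x y)
    (fXY_derivable : forall theta j x y, cube b x ->
       has_partial j (fun t => ln (fXY t x y)) theta)
    (fXY_bounded : exists M, forall theta j x y, cube b x ->
       `|partial j (fun t => ln (fXY t x y)) theta| <= M)
    (* assumption (2) *)
    (level_sets : forall theta y,
       finite_union_of_components
         [set x | cube b x /\ r x y <= VaR a (P theta) Rv])
    (* assumption (3) *)
    (fR_continuous : forall theta,
       {for VaR a (P theta) Rv, continuous (fR theta)})
    (fR_gt0 : forall theta, 0 < fR theta (VaR a (P theta) Rv))
    (g : 'I_k -> 'rV[R]_k -> R -> R)
    (g_def : forall j theta,
       is_cond_mean (P theta)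
         (fun w => score fY fXY j theta (X w) (Y w) *
                   (Rv w - VaR a (P theta) Rv))
         Rv (g j theta))
    (g_continuous : forall j theta,
       {for VaR a (P theta) Rv, continuous (g j theta)}) :
  forall (theta : 'rV[R]_k) (j : 'I_k)
    (* for each N, an i.i.d. sample of size N from the law of (X, Y) *)
    (dS : nat -> measure_display) (OmegaS : forall N, measurableType (dS N))
    (Q : forall N, probability (OmegaS N) R)
    (S : forall N, 'I_N -> {mfun OmegaS N >-> (n.-tuple R * YT)%type})
    (S_cube : forall N i w, cube b (S N i w).1)
    (S_iid : forall N, iid_sample (Q N) (S N)
       (pushforward (P theta) (fun w => (X w, Y w)))),
  (fun N => fine 'E_(Q N)[fun w => GCVaR a r (score fY fXY j theta)
                                     (fun i => S N i w)]
            - partial j (fun t => CVaR a (P t) Rv) theta)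
    =O_\oo (fun N => (Num.sqrt (N%:R : R))^-1).
Proof.
move=> theta j dS OmegaS Q S S_cube S_iid.
have [M rM] := r_bounded.
have [M1 fY_M1] := fY_bounded; have [M2 fXY_M2] := fXY_bounded.
have ha1 : 0 < a <= 1 by case/andP : ha => a0 a1; rewrite a0 ltW.
have a0 : 0 < a by case/andP : ha.
set nu := VaR a (P theta) Rv.
pose F z := fine (cdf (P := P theta) Rv z).
have RvM w : `|Rv w| <= M by rewrite Rv_def rM.
have nuM : `|nu| <= M by exact: (VaR_norm_le (P theta) ha RvM).
have M0 : 0 <= M by exact: le_trans (normr_ge0 _) nuM.
have Fnu : F nu = a by exact: (cdf_VaR ha RvM (@R_continuous theta)).
(* The range [2 * M] suffices because the true and the empirical quantile both lie in [[- M, M]]. *)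
have [c c0 growth] : exists2 c, 0 < c & forall t, 0 <= t <= 2 * M ->
    F nu + c * t <= F (nu + t) /\ F (nu - t) + c * t <= F nu.
  apply: (cdf_growth (fR_pdf theta) (@fR_continuous theta) (fR_gt0 theta)).
  by rewrite mulr_ge0.
pose sc := score fY fXY j theta.
have grad := partial_CVaR ha YT_countable YT_discrete X_cube fY_pmf fXY_pdf
  r_measurable rM Rv_def R_continuous (fun t => CVaR_derivable t j) fY_gt0
  (fun t y => @fY_derivable t j y) (fun t y => fY_M1 t j y) fXY_gt0
  (fun t x y => @fXY_derivable t j x y) (fun t x y => fXY_M2 t j x y) theta.
have scM x y : cube b x -> `|sc x y| <= M1 + M2.
  exact: (score_norm_le (fun t y => fY_M1 t j y) (fun t x y => fXY_M2 t j x y)).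
have msc y : measurable_fun (cube b) (sc ^~ y).
  apply: (measurable_score (fun t y => @fY_derivable t j y)
    (fun t x y => @fXY_derivable t j x y)) => t.
  by have [] := fXY_pdf t y.
pose E : set (n.-tuple R * YT) := cube b `*` setT.
have mC : measurable (cube b : set (n.-tuple R)) by exact: measurable_cube.
have mE : measurable E by exact: measurableX.
have mEfun (phi : n.-tuple R -> YT -> R) :
    (forall y, measurable_fun (cube b) (phi ^~ y)) ->
    measurable_fun E (fun p => phi p.1 p.2).
  move=> mphi; apply: (measurable_fun_countable2 YT_countable YT_discrete
    measurable_snd measurable_fst mE mC) => //.
  by move=> p [].
pose XYf w := (X w, Y w).
have mXY : measurable_fun setT XYf by exact: measurable_fun_pair.
pose XY : {mfun Omega >-> (n.-tuple R * YT)%type} :=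
  HB.pack XYf (isMeasurableFun.Build _ _ _ _ XYf mXY).
(* Intersecting with [E] makes the sublevel set measurable and leaves its preimages unchanged, since
   [(X, Y)] and the samples take values in [E]. *)
pose B z : set (n.-tuple R * YT) := E `&` [set p | r p.1 p.2 <= z].
have mB z : measurable (B z).
  rewrite (_ : B z = E `&` (fun p => r p.1 p.2) @^-1` `]-oo, z]).
    exact: (mEfun r).
  by apply/seteqP; split => p [Ep] /=; rewrite in_itv.
pose psi (p : n.-tuple R * YT) := Num.max (nu - r p.1 p.2) 0 * sc p.1 p.2.
pose gamma := \int[P theta]_w psi (XY w).
have Msc0 : 0 <= (M1 + M2) / a.
  by rewrite divr_ge0 ?(ltW a0)// (le_trans (normr_ge0 _) (scM _ (Y point) (X_cube point))).
have C0 : 0 <= 1 + 4 / c ^+ 2 by rewrite addr_ge0// divr_ge0// sqr_ge0.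
(* The Lipschitz constant of the estimator times the constant of [quantile_error]; the added 1
   ensures strict positivity. *)
apply/eqO_exP; exists ((M1 + M2) / a * (1 + 4 / c ^+ 2) + 1).
  by rewrite ltr_wpDl// mulr_ge0.
near=> N.
have N0 : (0 < N)%N by near: N; exact: nbhs_infty_gt.
pose V i w := r (S N i w).1 (S N i w).2.
have [law indep] := S_iid N.
have VB i z : [set w | V i w <= z] = S N i @^-1` B z.
  apply/seteqP; split => w /=; last by case.
  by move=> Vz; split => //; split => //; exact: S_cube.
have FE z : P theta (XY @^-1` B z) = (F z)%:E.
  rewrite fineK ?fin_num_measure// cdfE; congr (P theta _).
  apply/seteqP; split => w /=; first by case=> _; rewrite Rv_def.
  by rewrite Rv_def => Rz; split => //; split => //; exact: X_cube.
have VF i z : Q N [set w | V i w <= z] = (F z)%:E.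
  by rewrite VB law//; exact: FE.
have VF2 i i' z : i != i' ->
    Q N ([set w | V i w <= z] `&` [set w | V i' w <= z]) = (F z * F z)%:E.
  move=> ii'.
  (* Joint independence is specialised to the two-element index set, with the same event for both
     samples. *)
  have := indep [set i; i']%SET (fun=> B z) (fun=> mB z).
  rewrite big_setU1 ?inE//= big_set1 -!VB !VF -EFinM => <-.
  congr (Q N _); rewrite !VB; apply/seteqP; split => [w [Bi Bi'] i0 /=|w h].
    by rewrite !inE => /orP[] /eqP ->.
  by split; apply: h; rewrite /= !inE eqxx ?orbT.
have mS (phi : n.-tuple R -> YT -> R) i :
    (forall y, measurable_fun (cube b) (phi ^~ y)) ->
    measurable_fun setT (fun w => phi (S N i w).1 (S N i w).2).
  move=> mphi.
  have SE' : S N i @` setT `<=` E by move=> _ [w _ <-]; split => //; exact: S_cube.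
  have mSi : measurable_fun setT (S N i) by [].
  exact: (measurable_comp mE SE' (mEfun phi mphi) mSi).
pose s i w := sc (S N i w).1 (S N i w).2.
have SE i w : E (S N i w) by split => //; exact: S_cube.
have XYE w : E (XY w) by split => //; exact: X_cube.
have mpsi : measurable_fun E psi.
  apply: measurable_funM; last exact: (mEfun sc).
  apply: measurable_maxr => //; apply: measurable_funB => //.
  exact: (mEfun r).
have psiM p : E p -> `|psi p| <= 2 * M * (M1 + M2).
  move=> [bx _]; rewrite normrM ler_pM// ?scM//.
  rewrite ger0_norm ?le_max ?lexx ?orbT// ge_max mulr_ge0// andbT.
  rewrite (le_trans (ler_norm _))// (le_trans (ler_normB _ _))//.
  by rewrite mulr2n mulrDl mul1r lerD// rM.
have int_s i : \int[Q N]_w (Num.max (nu - V i w) 0 * s i w) = gamma.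
  exact: (eq_law_Rintegral mE (SE i) XYE mpsi psiM (law i)).
have bias := GCVaR_bias (Q := Q N) N0 ha1 (fun i => mS r i r_measurable)
  (fun i w => rM _ _ (S_cube N i w)) (fun i => mS sc i msc)
  (fun i w => scM _ _ (S_cube N i w)) nuM int_s.
have err := quantile_error (Q := Q N) N0 ha1 (fun i => mS r i r_measurable)
  (fun i w => rM _ _ (S_cube N i w)) VF VF2 nuM Fnu c0 growth.
have gradE : partial j (fun t => CVaR a (P t) Rv) theta = - (a^-1 * gamma).
  rewrite grad; congr (- (_ * _)); apply: eq_Rintegral => w _.
  by rewrite /psi /= -Rv_def.
(* The sign in the gradient formula turns the bias into the sum bounded by [GCVaR_bias]. *)
rewrite gradE opprK unlock.
apply: le_trans bias _.
rewrite [X in _ <= _ * X]ger0_norm ?invr_ge0 ?sqrtr_ge0// [leRHS]mulrDl mul1r.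
apply: (@le_trans _ _ ((M1 + M2) / a * (1 + 4 / c ^+ 2) * (Num.sqrt N%:R)^-1)).
  by rewrite -[leRHS]mulrA ler_wpM2l.
by rewrite lerDl invr_ge0 sqrtr_ge0.
Unshelve. all: by end_near.
Qed.
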